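(* Let $\{u^k\}_{k\ge 0}\subset V$ and $\{\lambda^k\}_{k\ge 0}\subset L^2(\Gamma^-)$ be the sequences produced by the Uzawa iteration: given $\lambda^0\in L^2(\Gamma^-)$, $$u^k:=\arg\min_{u\in V}L(u,\lambda^k),\qquad \lambda^{k+1}:=\lambda^k-\rho\,(u^k-g)\ \text{ in } L^2(\Gamma^-),\qquad k\ge 0.$$ If the parameters $\gamma$ and $\rho$ satisfy $0<\gamma$ and $0<\rho<2\gamma$, then $u^k$ converges to the solution $u^*$ in the $V$-norm, i.e. $\|u^k-u^*\|_V\to 0$ as $k\to\infty$.
   Context: Setting. $D\subset\mathbb{R}^d$, $d\in\{2,3\}$, is a spatial domain with outward unit normal $\vec n(\vec x)$ on $\partial D$; $\mathcal W:=D\times\mathbb{S}^{d-1}$; $\Gamma^{\pm}:=\{(\vec x,\vec\omega)\in\partial D\times\mathbb{S}^{d-1}:\pm\,\vec n(\vec x)\cdot\vec\omega>0\}$. Constants $\sigma_A,\sigma_T\ge 0$ are given, and $\pi\in C^1([-1,1];\mathbb{R}_{\ge 0})$ satisfies $\int_{-1}^1\pi(y)\,dy=1$. Define $$\mathcal T u:=\vec\omega\cdot\nabla_{\vec x}u+\sigma_A u,\qquad \mathcal S u:=\sigma_T\Big(u-\frac{1}{|\mathbb{S}^{d-1}|}\int_{\mathbb{S}^{d-1}}\pi(\vec\omega\cdot\vec\omega')\,u(\vec x,\vec\omega')\,d\vec\omega'\Big).$$ $L^2(\Gamma^-)$ carries the inner product $\langle u,v\rangle_{L^2(\Gamma^-)}=\int_{\Gamma^-}u\,v\,|\vec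 n(\vec x)\cdot\vec\omega|\,d\vec\omega\,d\vec x$ and the corresponding norm. The space is $$V:=\{u\in L^2(\mathcal W):\ \mathcal T u+\mathcal S u\in L^2(\mathcal W),\ u|_{\Gamma^-}\in L^2(\Gamma^-)\},\qquad \|u\|_V^2:=\|(\mathcal T+\mathcal S)u\|_{L^2(\mathcal W)}^2+\|u\|_{L^2(\Gamma^-)}^2.$$ Given $g\in L^2(\Gamma^-)$, the boundary value problem is: find $u^*\in V$ with $\mathcal T u^*+\mathcal S u^*=0$ in $\mathcal W$ and $u^*=g$ on $\Gamma^-$. With $\gamma$ the stabilisation parameter, set $$J(u):=\tfrac12\|\mathcal T u+\mathcal S u\|_{L^2(\mathcal W)}^2+\tfrac{\gamma}{2}\|u-g\|_{L^2(\Gamma^-)}^2,\qquad L(u,\lambda):=J(u)-\langle\lambda,u-g\rangle_{L^2(\Gamma^-)}.$$ $(u^*,\lambda^* )\in V\times L^2(\Gamma^-)$ denotes the saddle point of $\min_{u\in V}\max_{\lambda\in L^2(\Gamma^-)}L(u,\lambda)$, whose first component $u^*$ is the solution of the boundary value problem. *)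

(* Defs.v *)
From HB Require Import structures.
From mathcomp Require Import all_boot all_order all_algebra.
From mathcomp Require Import all_classical all_reals all_analysis measurable_realfun.
From mathcomp Require Import lra.
Set Implicit Arguments. Unset Strict Implicit. Unset Printing Implicit Defensive.
Import Order.TTheory GRing.Theory Num.Theory numFieldNormedType.Exports.
Local Open Scope classical_set_scope.
Local Open Scope ring_scope.

(* Row vectors carry the product sigma-algebra, which is the Borel one over R. *)
Definition row_display : measure_display -> measure_display.
Proof. exact. Qed.

Section row_measurable.
Context {d} {T : sigmaRingType d} (n : nat).

Let coord : 'I_n -> 'rV[T]_n -> T := fun i x => x 0 i.

Let row_set0 : g_sigma_preimage coord set0.
Proof. exact: sigma_algebra0. Qed.

Let row_setC A : g_sigma_preimage coord A -> g_sigma_preimage coord (~` A).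
Proof. exact: sigma_algebraC. Qed.

Let row_bigcup (F : (set 'rV[T]_n)^nat) : (forall i, g_sigma_preimage coord (F i)) ->
  g_sigma_preimage coord (\bigcup_i F i).
Proof. exact: sigma_algebra_bigcup. Qed.

HB.instance Definition _ := @isMeasurable.Build (row_display d)
  'rV[T]_n (g_sigma_preimage coord) row_set0 row_setC row_bigcup.

End row_measurable.

Lemma measurable_coord d (T : sigmaRingType d) n (i : 'I_n) :
  measurable_fun [set: 'rV[T]_n] (fun x => x 0 i).
Proof.
move=> _ Y mY; rewrite setTI; apply: sub_sigma_algebra => /=.
rewrite -bigcup_seq/=; exists i => /=; first by rewrite mem_index_enum.
by exists Y => //; rewrite setTI.
Qed.

Lemma measurable_fun_rowP d d' (T1 : measurableType d) (T : measurableType d') n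
    (f : T1 -> 'rV[T]_n) :
  (forall i, measurable_fun [set: T1] (fun t => f t 0 i)) ->
  measurable_fun [set: T1] f.
Proof.
move=> mf; have fS : preimage_set_system [set: T1] f measurable `<=` measurable.
  rewrite /measurable/= -(g_sigma_preimage_comp (fun i (x : 'rV[T]_n) => x 0 i)).
  apply: smallest_sub; first exact: sigma_algebra_measurable.
  case: n => [|n] in f mf *; first by rewrite big_ord0.
  rewrite -bigcup_mkord_ord; apply: bigcup_sub => i Ii.
  by move=> A [B mB <-]; exact: mf.
by move=> _ A mA; apply: fS; exists A.
Qed.

Section lebesgue_row.
Context {R : realType}.

Definition row_cons n (p : measurableTypeR R * 'rV[R]_n) : 'rV[R]_n.+1 :=
  row_mx (p.1)%:M p.2.

Lemma row_cons0 n p : @row_cons n p 0 0 = p.1.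
Proof.
rewrite /row_cons (_ : 0 = lshift n (0 : 'I_1)); last exact/val_inj.
by rewrite (@row_mxEl _ 1 1 n) mxE eqxx mulr1n.
Qed.

Lemma row_consS n p j : @row_cons n p 0 (lift 0 j) = p.2 0 j.
Proof.
rewrite /row_cons (_ : lift 0 j = rshift 1 j); last exact/val_inj.
by rewrite (@row_mxEr _ 1 1 n).
Qed.

Lemma measurable_row_cons n : measurable_fun setT (@row_cons n).
Proof.
apply: measurable_fun_rowP => i; case: (unliftP 0 i) => [j|] ->.
  rewrite (_ : (fun _ => _) = (fun y : 'rV[R]_n => y 0 j) \o snd); last first.
    by apply/funext => p /=; rewrite row_consS.
  by apply: measurableT_comp => //; exact: measurable_coord.
rewrite (_ : (fun _ => _) = fst) //.
by apply/funext => p /=; rewrite row_cons0.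
Qed.

Section step.
Context n (mu : {sigma_finite_measure set 'rV[R]_n -> \bar R}).

Definition lebesgue_step : set 'rV[R]_n.+1 -> \bar R :=
  pushforward (@lebesgue_measure R \x mu)%E (@row_cons n).

Let lebesgue_step0 : lebesgue_step set0 = 0%E.
Proof. by rewrite /lebesgue_step /pushforward preimage_set0 measure0. Qed.

Let lebesgue_step_ge0 A : (0 <= lebesgue_step A)%E.
Proof. by rewrite /lebesgue_step /pushforward; exact: measure_ge0. Qed.

Let lebesgue_step_sigma_additive : semi_sigma_additive lebesgue_step.
Proof.
pose m : {measure set (measurableTypeR R * 'rV[R]_n) -> \bar R} :=
  (@lebesgue_measure R \x mu)%E.
exact: (@measure_semi_sigma_additive _ _ _
  (measure_function_pushforward__canonical__measure_function_Measure
     m (@measurable_row_cons n))).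
Qed.

HB.instance Definition _ := isMeasure.Build _ _ _ lebesgue_step
  lebesgue_step0 lebesgue_step_ge0 lebesgue_step_sigma_additive.

Lemma lebesgue_step_sigma_finite : sigma_finite setT lebesgue_step.
Proof.
have /sigma_finiteP[F [TF ndF Foo]] :=
  @sigma_finiteT _ _ _ (@lebesgue_measure R : {sigma_finite_measure set (measurableTypeR R) -> \bar R}).
have /sigma_finiteP[G [TG ndG Goo]] := sigma_finiteT mu.
pose f (x : 'rV[R]_n.+1) : measurableTypeR R * 'rV[R]_n :=
  (x 0 0, \row_j x 0 (lift 0 j)).
have mf : measurable_fun setT f.
  apply/measurable_fun_pairP; split; first exact: measurable_coord.
  apply: measurable_fun_rowP => i /=; under eq_fun do rewrite mxE.
  exact: measurable_coord.
have fK p : f (row_cons p) = p.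
  case: p => a y; rewrite /f row_cons0; congr (_, _).
  by apply/rowP => j; rewrite mxE row_consS.
exists (fun k => f @^-1` (F k `*` G k)).
  rewrite -preimage_bigcup; apply/esym; rewrite -subTset => x _.
  have [i _ Fi] : (\bigcup_k F k) (f x).1 by rewrite -TF.
  have [j _ Gj] : (\bigcup_k G k) (f x).2 by rewrite -TG.
  exists (maxn i j) => //; split.
    by move: Fi; exact/subsetPset/ndF/leq_maxl.
  by move: Gj; exact/subsetPset/ndG/leq_maxr.
move=> k; have [mFk Fk] := Foo k; have [mGk Gk] := Goo k.
have mFG : measurable (F k `*` G k) by exact: measurableX.
split; first by rewrite -[X in measurable X]setTI; exact: mf.
rewrite /lebesgue_step /pushforward -comp_preimage.
rewrite (_ : f \o _ = id) ?product_measure1E//; last exact/funext.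
by rewrite lte_mul_pinfty// ge0_fin_numE.
Qed.

HB.instance Definition _ := @Measure_isSigmaFinite.Build _ _ _
  lebesgue_step lebesgue_step_sigma_finite.
End step.

Fixpoint lebesgue_row n : {sigma_finite_measure set 'rV[R]_n -> \bar R} :=
  match n with
  | 0 => dirac (0 : 'rV[R]_0)
  | m.+1 => lebesgue_step (lebesgue_row m)
  end.
End lebesgue_row.
Section euclidean.
Context {R : realType} {n : nat}.
Implicit Types x y : 'rV[R]_n.

Definition dot x y : R := \sum_i x 0 i * y 0 i.
Definition enorm x : R := Num.sqrt (dot x x).
Definition sphere : set 'rV[R]_n := [set w | enorm w = 1].
Definition closed_unit_ball : set 'rV[R]_n := [set x | enorm x <= 1].

Lemma measurable_enorm : measurable_fun setT enorm.
Proof.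
apply: (measurableT_comp (f := @Num.sqrt R)) => //.
  by apply: continuous_measurable_fun; exact: sqrt_continuous.
rewrite (_ : (fun x => dot x x) = (fun x => \sum_(i <- index_enum 'I_n) x 0 i * x 0 i)) //.
apply: measurable_sum => i.
by apply: measurable_funM; exact: measurable_coord.
Qed.

Lemma coord_le_enorm x i : `|x 0 i| <= enorm x.
Proof.
rewrite -sqrtr_sqr ler_sqrt; last by rewrite sumr_ge0// => j _; rewrite -expr2 sqr_ge0.
rewrite /dot (bigD1 i)//= -expr2 lerDl sumr_ge0// => j _.
by rewrite -expr2 sqr_ge0.
Qed.

Definition sphere_cone (A : set 'rV[R]_n) : set 'rV[R]_n :=
  [set x | 0 < enorm x <= 1 /\ A ((enorm x)^-1 *: x)].

Lemma measurable_sphere_cone A : measurable A -> measurable (sphere_cone A).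
Proof.
move=> mA.
have -> : sphere_cone A = (enorm @^-1` `]0, 1]) `&` ((fun x => (enorm x)^-1 *: x) @^-1` A).
  by apply/seteqP; split => x /=; rewrite in_itv.
apply: measurableI; rewrite -[X in measurable X]setTI.
  exact: measurable_enorm.
apply: (measurable_fun_rowP (f := fun x => (enorm x)^-1 *: x)) => // i.
under eq_fun do rewrite mxE.
apply: measurable_funM; last exact: measurable_coord.
rewrite (_ : (fun _ => _) = (fun x => enorm x `^ -1)).
  by apply: (measurableT_comp (measurable_powR _)); exact: measurable_enorm.
by apply/funext => x; rewrite powR_inv1// sqrtr_ge0.
Qed.
End euclidean.
Arguments sphere {R n}.

Lemma measurable_row_box (R : realType) n (r : R) :
  measurable [set x : 'rV[R]_n | forall i, `|x 0 i| <= r].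
Proof.
rewrite (_ : [set _ | _] =
    \bigcap_(i in [set: 'I_n]) (fun x : 'rV[R]_n => x 0 i) @^-1` `[- r, r]).
  apply: fin_bigcap_measurable => // i _.
  by rewrite -[X in measurable X]setTI; exact: measurable_coord.
apply/seteqP; split => x /= H i; last by move: (H i I); rewrite /= in_itv/= -ler_norml.
by move=> _ /=; rewrite in_itv/= -ler_norml.
Qed.

Lemma lebesgue_row_box (R : realType) n (r : R) : 0 <= r ->
  lebesgue_row n [set x : 'rV[R]_n | forall i, `|x 0 i| <= r] = ((2 * r) ^+ n)%:E.
Proof.
move=> r0; elim: n => [|n ih].
  by rewrite /= diracE mem_set//= => -[].
rewrite /= /lebesgue_step /pushforward.
have -> : @row_cons R n @^-1` [set x | forall i, `|x 0 i| <= r] =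
    (`[- r, r]%classic : set (measurableTypeR R)) `*`
      [set x : 'rV[R]_n | forall i, `|x 0 i| <= r].
  apply/seteqP; split => p /=.
    move=> H; split; first by rewrite in_itv/= -ler_norml -row_cons0.
    by move=> i; rewrite -row_consS.
  rewrite in_itv/= -ler_norml => -[h0 hS] i.
  by case: (unliftP 0 i) => [j|] ->; rewrite ?row_cons0 ?row_consS.
rewrite product_measure1E//; last exact: measurable_row_box.
rewrite [X in (_ * X)%E]ih.
rewrite exprS EFinM; congr (_ * _)%E.
rewrite [LHS](lebesgue_measure_itv `[- r, r])/= lte_fin.
case: ifPn => [_|]; first by rewrite -EFinB; congr EFin; lra.
by rewrite -leNgt => rr; congr EFin; lra.
Qed.

Section sphere_measure.
Context {R : realType} {n : nat}.

(* Surface measure of the unit sphere, by polar coordinates: n times the volume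
   of the cone over A inside the unit ball. *)
Definition sphere_measure (A : set 'rV[R]_n) : \bar R :=
  (n%:R%:E * lebesgue_row n (sphere_cone A))%E.

Let sphere_measure0 : sphere_measure set0 = 0%E.
Proof.
rewrite /sphere_measure (_ : sphere_cone _ = set0) ?measure0 ?mule0//.
by apply/seteqP; split => x // -[].
Qed.

Let sphere_measure_ge0 A : (0 <= sphere_measure A)%E.
Proof. by rewrite /sphere_measure mule_ge0// lee_fin. Qed.

Let sphere_measure_sigma_additive : semi_sigma_additive sphere_measure.
Proof.
move=> F mF tF mUF; rewrite /sphere_measure.
have -> : sphere_cone (\bigcup_k F k) = \bigcup_k sphere_cone (F k).
  apply/seteqP; split => [x [x1 [k _ Fk]]|x [k _ [x1 Fk]]].
    by exists k.
  by split => //; exists k.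
have H : (fun m => \sum_(0 <= i < m) lebesgue_row n (sphere_cone (F i)))%E @ \oo -->
    lebesgue_row n (\bigcup_k sphere_cone (F k)).
  apply: measure_semi_sigma_additive.
  - by move=> k; exact: measurable_sphere_cone.
  - apply/trivIsetP => i j _ _ ij; apply/seteqP; split => x // -[[_ Fi] [_ Fj]].
    by move/trivIsetP : tF => /(_ _ _ I I ij) /seteqP[/(_ _ (conj Fi Fj))].
  - by apply: bigcup_measurable => k _; exact: measurable_sphere_cone.
rewrite (_ : (fun _ => _) =
    (fun m => n%:R%:E * \sum_(0 <= i < m) lebesgue_row n (sphere_cone (F i)))%E).
  by apply: cvgeZl.
by apply/funext => m; rewrite ge0_sume_distrr.
Qed.

HB.instance Definition _ := isMeasure.Build _ _ _ sphere_measure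
  sphere_measure0 sphere_measure_ge0 sphere_measure_sigma_additive.

Let sphere_measure_finite : fin_num_fun sphere_measure.
Proof.
move=> A mA; rewrite /sphere_measure fin_numM// ge0_fin_numE//.
apply: (@le_lt_trans _ _ (lebesgue_row n [set x : 'rV[R]_n | forall i, `|x 0 i| <= 1])).
  apply: le_measure; rewrite ?inE; first exact: measurable_sphere_cone.
    exact: measurable_row_box.
  by move=> x [/andP[_ x1] _] i; apply: le_trans x1; exact: coord_le_enorm.
by rewrite lebesgue_row_box// ltry.
Qed.

HB.instance Definition _ := Measure_isFinite.Build _ _ _
  sphere_measure sphere_measure_finite.

End sphere_measure.

Section hausdorff.
Context {R : realType} {n : nat}.
Local Open Scope ereal_scope.
Implicit Types (A B U : set 'rV[R]_n) (d : R) (m : nat).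

(* m-dimensional Hausdorff measure for the Euclidean distance, normalised by the
   volume of the unit ball of R^m so that it is surface measure on hypersurfaces
   of R^(m + 1). *)
Definition diam U : \bar R :=
  ereal_sup [set (enorm (x - y)%R)%:E | x in U & y in U].

Definition hausdorff_gauge m U : \bar R :=
  if U == set0 then 0 else
  (fine (@lebesgue_row R m closed_unit_ball) * (fine (diam U) / 2) ^+ m)%:E.

Definition hausdorff_cover d A : set (set 'rV[R]_n)^nat :=
  [set U | (forall k, diam (U k) <= d%:E) /\ A `<=` \bigcup_k U k].

Definition hausdorff_pre m d A : \bar R :=
  ereal_inf [set \sum_(k <oo) hausdorff_gauge m (U k) | U in hausdorff_cover d A].

Definition hausdorff m A : \bar R :=
  ereal_sup [set hausdorff_pre m d A | d in [set d | (0 < d)%R]].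

Lemma hausdorff_gauge_ge0 m U : 0 <= hausdorff_gauge m U.
Proof.
rewrite /hausdorff_gauge; case: ifPn => // /set0P[x Ux].
rewrite lee_fin mulr_ge0//; first exact: fine_ge0.
rewrite exprn_ge0// divr_ge0// fine_ge0//.
apply: ereal_sup_ubound; exists x => //; exists x => //.
by rewrite subrr /enorm (_ : dot _ _ = 0%R) ?sqrtr0// /dot big1// => i _; rewrite mxE mul0r.
Qed.
Local Hint Resolve hausdorff_gauge_ge0 : core.

Lemma hausdorff_gauge0 m : hausdorff_gauge m set0 = 0.
Proof. by rewrite /hausdorff_gauge eqxx. Qed.

Lemma diam0 : diam set0 = -oo.
Proof.
rewrite /diam (_ : [set _ | _ in _ & _ in _] = set0) ?ereal_sup0//.
by apply/seteqP; split => x // -[].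
Qed.

Lemma hausdorff_pre_ge0 m d A : 0 <= hausdorff_pre m d A.
Proof. by apply: le_ereal_inf_tmp => _ [U _ <-]; exact: nneseries_ge0. Qed.

Lemma le_hausdorff_pre m d : {homo hausdorff_pre m d : A B / A `<=` B >-> A <= B}.
Proof.
move=> A B AB; apply: ereal_inf_le_tmp => _ [U [dU BU] <-].
by exists U => //; split=> //; apply: subset_trans BU.
Qed.

Lemma hausdorff_pre_anti m d d' A : (d <= d')%R ->
  hausdorff_pre m d' A <= hausdorff_pre m d A.
Proof.
move=> dd'; apply: ereal_inf_le_tmp => _ [U [dU AU] <-]; exists U => //.
by split => // k; apply: le_trans (dU k) _; rewrite lee_fin.
Qed.

Lemma hausdorff_pre0 m d : hausdorff_pre m d set0 = 0.
Proof.
apply/eqP; rewrite eq_le hausdorff_pre_ge0 andbT.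
apply: ereal_inf_lbound; exists (fun=> set0).
  by split => // k; rewrite diam0 leNye.
by rewrite eseries0// => i _ _; rewrite hausdorff_gauge0.
Qed.

Lemma hausdorff_pre_sigma_subadditive m d : sigma_subadditive (hausdorff_pre m d).
Proof.
move=> A; have [[i ioo]|] := pselect (exists i, hausdorff_pre m d (A i) = +oo).
  rewrite (eseries_pinfty _ _ ioo) ?leey// => k _.
  by rewrite -ltNye (lt_le_trans _ (hausdorff_pre_ge0 _ _ _)).
rewrite -forallNE => Aoo.
apply/lee_addgt0Pr => e e0.
rewrite (le_trans _ (epsilon_trick _ _ _))//; last 2 first.
- by move=> k; exact: hausdorff_pre_ge0.
- exact: ltW.
pose P k (B : (set 'rV[R]_n)^nat) := hausdorff_cover d (A k) B /\
  \sum_(i <oo) hausdorff_gauge m (B i) <=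
  hausdorff_pre m d (A k) + (e / (2 ^ k.+1)%:R)%:E.
have [G PG] : {G : ((set 'rV[R]_n)^nat)^nat & forall k, P k (G k)}.
  apply: (@choice _ _ P) => k.
  have Sfin : hausdorff_pre m d (A k) \is a fin_num.
    by rewrite ge0_fin_numE ?hausdorff_pre_ge0// ltey; apply/eqP; exact: Aoo.
  have ek : (0 < e / (2 ^ k.+1)%:R)%R by rewrite divr_gt0// ltr0n expn_gt0.
  have [_ [B AB <-] BS] := lb_ereal_inf_adherent ek Sfin.
  by exists B; split => //; exact/ltW.
pose g := hausdorff_gauge m \o uncurry G.
have g_ge0 x : 0 <= g x by exact: hausdorff_gauge_ge0.
apply: (@le_trans _ _ (\esum_(i in setT) g i)).
  apply: ereal_inf_lbound => /=.
  have /card_esym/ppcard_eqP[f] := card_nat2.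
  exists (uncurry G \o f).
    split.
      move=> i /=; case: (f i) => a b /=.
      by case: (PG a) => -[dG _] _; exact: dG.
    move=> t [i _ Ait]; have [j _ Gt] := (PG i).1.2 t Ait; exists (f^-1%FUN (i, j)) => //=.
    by rewrite invK ?inE.
  rewrite -(esum_pred_image g _ xpredT) ?[fun=> _]set_true//.
  by rewrite image_eq.
rewrite (_ : esum _ _ = \sum_(i <oo) \sum_(j <oo) hausdorff_gauge m (G i j)); last first.
  pose J : nat -> set (nat * nat) := fun i => [set (i, j) | j in setT].
  rewrite (_ : setT = \bigcup_k J k); last first.
    by rewrite predeqE => -[a b]; split => // _; exists a => //; exists b.
  rewrite esum_bigcupT /=; last 2 first.
    - apply/trivIsetP => i j _ _ ij.
      rewrite predeqE => -[k l] /=; split => //= -[] [_] _ [<-{k} _].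
      by move=> [m' _] [] /esym/eqP; rewrite (negbTE ij).
    - by move=> /= [k l]; exact: g_ge0.
  rewrite -(image_id [set: nat]) -fun_true esum_pred_image//; last first.
    by move=> k _; exact: esum_ge0.
  apply: eq_eseriesr => /= j _.
  rewrite -(esum_pred_image g (pair j) predT)//=; last first.
    by move=> ? ? _ _; exact: (@can_inj _ _ _ snd).
  by congr esum; rewrite predeqE => -[a b]; split; move=> [i _ <-]; exists i.
apply: lee_nneseries => k *; first by apply: nneseries_ge0 => *; exact: (g_ge0 (k, _)).
exact: (PG k).2.
Qed.

Lemma hausdorff_ge0 m A : 0 <= hausdorff m A.
Proof.
apply: le_ereal_sup_tmp; exists (hausdorff_pre m 1 A); last exact: hausdorff_pre_ge0.
by exists 1%R => //=.
Qed.

Lemma hausdorff0 m : hausdorff m set0 = 0.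
Proof.
apply/eqP; rewrite eq_le hausdorff_ge0 andbT.
by apply: ge_ereal_sup => _ [d _ <-]; rewrite hausdorff_pre0.
Qed.

Lemma hausdorff_pre_le m d A : (0 < d)%R -> hausdorff_pre m d A <= hausdorff m A.
Proof. by move=> d0; apply: ereal_sup_ubound; exists d. Qed.

Lemma le_hausdorff m : {homo hausdorff m : A B / A `<=` B >-> A <= B}.
Proof.
move=> A B AB; apply: ge_ereal_sup => _ [d d0 <-].
by apply: le_trans (hausdorff_pre_le m B d0); exact: le_hausdorff_pre.
Qed.

Lemma hausdorff_sigma_subadditive m : sigma_subadditive (hausdorff m).
Proof.
move=> F; apply: ge_ereal_sup => _ [d d0 <-].
apply: le_trans (hausdorff_pre_sigma_subadditive m d F) _.
apply: lee_nneseries => k *; first exact: hausdorff_pre_ge0.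
exact: hausdorff_pre_le.
Qed.

HB.instance Definition _ m := isOuterMeasure.Build R 'rV[R]_n (hausdorff m)
  (hausdorff0 m) (hausdorff_ge0 m) (@le_hausdorff m)
  (@hausdorff_sigma_subadditive m).

Lemma hausdorff_pre_separated m d e A B : (d < e)%R ->
  (forall x y, A x -> B y -> (e <= enorm (x - y))%R) ->
  hausdorff_pre m d A + hausdorff_pre m d B <= hausdorff_pre m d (A `|` B).
Proof.
move=> de sepAB; apply: le_ereal_inf_tmp => _ [U [dU ABU] <-].
pose V (C : set 'rV[R]_n) k := if U k `&` C == set0 then set0 else U k.
have VU (C : set 'rV[R]_n) : C `<=` A `|` B -> hausdorff_cover d C (V C).
  move=> CAB; split=> [k|x Cx]; first by rewrite /V; case: ifP; rewrite ?diam0 ?leNye.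
  have [k _ Ukx] := ABU x (CAB _ Cx); exists k => //; rewrite /V.
  by case: ifPn => // /eqP/seteqP[/(_ x (conj Ukx Cx))].
have VP k : hausdorff_gauge m (V A k) + hausdorff_gauge m (V B k) <= hausdorff_gauge m (U k).
  rewrite /V; case: ifPn => [_|/set0P[x [Ux Ax]]]; last case: ifPn => [_|/set0P[y [Uy By]]].
  - by rewrite hausdorff_gauge0 add0e; case: ifP => // _; rewrite hausdorff_gauge0.
  - by rewrite hausdorff_gauge0 adde0.
  - have : (enorm (x - y)%R)%:E <= d%:E.
      by apply: le_trans (dU k); apply: ereal_sup_ubound; exists x => //; exists y.
    by rewrite lee_fin leNgt (lt_le_trans de)// sepAB.
apply: (@le_trans _ _ (\sum_(k <oo) (hausdorff_gauge m (V A k) + hausdorff_gauge m (V B k)))).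
  rewrite nneseriesD//; apply: leeD; apply: ereal_inf_lbound.
    by exists (V A) => //; apply: VU => x; left.
  by exists (V B) => //; apply: VU => x; right.
by apply: lee_nneseries => // k *; exact: adde_ge0.
Qed.

Lemma hausdorff_separated m (s t : R) (i : 'I_n) A B : (s < t)%R ->
  (forall x, A x -> (x 0 i <= s)%R) -> (forall y, B y -> (t <= y 0 i)%R) ->
  hausdorff m A + hausdorff m B <= hausdorff m (A `|` B).
Proof.
move=> st As tB.
have sep x y : A x -> B y -> (t - s <= enorm (x - y))%R.
  move=> /As xs /tB ty; apply: le_trans (coord_le_enorm (x - y)%R i).
  by rewrite !mxE distrC ler_normr lerB.
have ts0 : (0 < t - s)%R by rewrite subr_gt0.
have H d1 d2 : (0 < d1)%R -> (0 < d2)%R ->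
    hausdorff_pre m d1 A + hausdorff_pre m d2 B <= hausdorff m (A `|` B).
  move=> d10 d20; pose d := (Num.min (Num.min d1 d2) ((t - s) / 2))%R.
  have d0 : (0 < d)%R by rewrite !lt_min d10 d20 divr_gt0.
  have dts : (d < t - s)%R.
    by rewrite /d !gt_min ltr_pdivrMr// ltr_pMr// ltr1n orbT.
  apply: le_trans (hausdorff_pre_le m _ d0).
  apply: le_trans (hausdorff_pre_separated m dts sep).
  by apply: leeD; apply: hausdorff_pre_anti; rewrite /d !ge_min lexx ?orbT.
have [->|ABoo] := eqVneq (hausdorff m (A `|` B)) +oo; first exact: leey.
have ABfin : hausdorff m (A `|` B) \is a fin_num.
  by rewrite ge0_fin_numE ?hausdorff_ge0// ltey.
have Bfin : hausdorff m B \is a fin_num.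
  rewrite ge0_fin_numE ?hausdorff_ge0//; apply: le_lt_trans (_ : _ <= hausdorff m (A `|` B)) _.
    by apply: le_hausdorff => x; right.
  by rewrite ltey.
rewrite -leeBrDr//; apply: ge_ereal_sup => _ [d1 d10 <-].
rewrite leeBrDr// addeC -leeBrDr; last first.
  rewrite ge0_fin_numE ?hausdorff_pre_ge0//.
  apply: le_lt_trans (hausdorff_pre_le m _ d10) _.
  apply: le_lt_trans (_ : _ <= hausdorff m (A `|` B)) _; last by rewrite ltey.
  by apply: le_hausdorff => x; left.
apply: ge_ereal_sup => _ [d2 d20 <-].
rewrite leeBrDr; first by rewrite addeC; exact: H.
rewrite ge0_fin_numE ?hausdorff_pre_ge0//.
apply: le_lt_trans (hausdorff_pre_le m _ d10) _.
apply: le_lt_trans (_ : _ <= hausdorff m (A `|` B)) _; last by rewrite ltey.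
by apply: le_hausdorff => x; left.
Qed.
End hausdorff.

Section caratheodory.
Context {R : realType} {n : nat}.
Local Open Scope ereal_scope.

Lemma hausdorff_half_space m (i : 'I_n) (c : R) :
  (hausdorff m).-caratheodory [set x : 'rV[R]_n | (x 0 i < c)%R].
Proof.
apply: le_caratheodory_measurable => X.
set E := [set x : 'rV[R]_n | (x 0 i < c)%R].
change (hausdorff m (X `&` E) + hausdorff m (X `&` ~` E) <= hausdorff m X).
have [->|Xoo] := eqVneq (hausdorff m X) +oo; first exact: leey.
have Xfin : hausdorff m X < +oo by rewrite ltey.
pose a k : R := (c - k.+1%:R^-1)%R.
have a_lt k l : (k < l)%N -> (a k < a l)%R.
  by move=> kl; rewrite /a ltrD2l ltrN2 ltf_pV2 ?posrE// ltr_nat.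
have ac k : (a k < c)%R by rewrite /a ltrBlDr ltrDl invr_gt0.
pose strip k := X `&` [set x | (a k <= x 0 i < a k.+1)%R].
have half p N : \sum_(j < N) hausdorff m (strip (j.*2 + p)%N) <= hausdorff m X.
  pose b N := if N is M.+1 then a (M.*2 + p).+1 else (a p - 1)%R.
  have ba M : (b M < a (M.*2 + p)%N)%R.
    case: M => [|M] /=; first by rewrite ltrBlDr ltrDl.
    by apply: a_lt; rewrite doubleS.
  apply: (@le_trans _ _ (hausdorff m (X `&` [set x | (x 0 i <= b N)%R]))); last first.
    by apply: le_hausdorff => x [].
  elim: N => [|N ih]; first by rewrite big_ord0 hausdorff_ge0.
  rewrite big_ord_recr/=; apply: le_trans (leeD2r _ ih) _.
  apply: le_trans (hausdorff_separated m (i := i) (ba N) _ _) _.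
  - by move=> x [].
  - by move=> y [_ /andP[]].
  apply: le_hausdorff => x [[Xx xb]|[Xx /andP[_ xa]]]; split => //=; last exact: ltW.
  apply: le_trans xb _; apply: le_trans (ltW (ba N)) _.
  by apply/ltW/a_lt.
have sum_le N : \sum_(0 <= j < N) hausdorff m (strip j) <= hausdorff m X + hausdorff m X.
  apply: (@le_trans _ _ (\sum_(0 <= j < N.*2) hausdorff m (strip j))).
    rewrite [leRHS](@big_cat_nat _ _ _ N)//=; last by rewrite -addnn leq_addr.
    by rewrite leeDl// sume_ge0// => *; exact: hausdorff_ge0.
  apply: le_trans (leeD (half 0%N N) (half 1%N N)).
  rewrite -big_split/=; elim: N => [|N ih]; first by rewrite big_geq// big_ord0.
  rewrite doubleS !big_nat_recr//= big_ord_recr/= addn0 addn1 -addeA.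
  exact: leeD2r.
have tail : \sum_(N <= k <oo) hausdorff m (strip k) @[N --> \oo] --> 0.
  apply: nneseries_tail_cvg => [|k _]; last exact: hausdorff_ge0.
  apply: (@le_lt_trans _ _ (hausdorff m X + hausdorff m X)); last first.
    by rewrite lte_add_pinfty.
  apply: lime_le; first by apply: is_cvg_nneseries => *; exact: hausdorff_ge0.
  by near=> N; exact: sum_le.
apply/lee_addgt0Pr => e e0.
have [N _ /(_ N (leqnn _)) tailN] : \forall N \near \oo,
    \sum_(N <= k <oo) hausdorff m (strip k) < e%:E.
  apply: (tail [set y | y < e%:E]); apply: open_nbhs_nbhs; split.
    exact: open_ereal_lt_ereal.
  by rewrite /= lte_fin.
have XE : X `&` E `<=` (X `&` [set x | (x 0 i <= a N)%R]) `|`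
    \bigcup_(k in ~` `I_N) strip k.
  move=> x [Xx xc]; have [xa|ax] := leP (x 0%R i) (a N); first by left.
  right.
  have exk : exists k, (x 0 i < a k.+1)%R.
    have [k ck] : exists k, (k.+1%:R^-1 < c - x 0 i)%R.
      have /ltr_add_invr[k] : (x 0 i < c)%R by [].
      by exists k; rewrite ltrBrDl.
    exists k; apply: (lt_trans _ (a_lt _ _ (ltnSn k))).
    by rewrite /a ltrBrDr addrC -ltrBrDr.
  case: (ex_minnP exk) => k xk kmin.
  have ak : (a k <= x 0 i)%R.
    rewrite leNgt; apply/negP; case: k xk kmin => [|k] xk kmin xak.
      have := lt_trans ax xak; apply/negP; rewrite -leNgt.
      by case: (N) => [|M]//; apply/ltW/a_lt.
    by have := kmin k xak; rewrite ltnn.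
  exists k; last by split => //=; rewrite ak.
  apply/negP; rewrite -leqNgt leqNgt; apply/negP => kN.
  have := lt_trans ax xk; apply/negP; rewrite -leNgt.
  by move: kN; rewrite leq_eqVlt => /orP[/eqP<-//|/a_lt/ltW].
apply: (@le_trans _ _ (hausdorff m (X `&` [set x | (x 0 i <= a N)%R]) +
    hausdorff m (X `&` ~` E) + e%:E)).
  rewrite addeAC leeD2r//.
  apply: le_trans (le_hausdorff m XE) _.
  apply: le_trans (outer_measureU2 _ _ _) _; rewrite leeD2l//.
  apply: le_trans (outer_measure_sigma_subadditive_tail _ _ _) _.
  exact: ltW.
rewrite leeD2r//.
apply: le_trans (hausdorff_separated m (i := i) (ac N) _ _) _.
- by move=> x [].
- by move=> y [_] /negP; rewrite -leNgt.
by apply: le_hausdorff => x [[]|[]].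
Unshelve. all: by end_near. Qed.

Lemma measurable_hausdorff_caratheodory m (A : set 'rV[R]_n) :
  measurable A -> (hausdorff m).-caratheodory A.
Proof.
pose T := caratheodory_type (@hausdorff R n m).
have mid : measurable_fun [set: T] (id : T -> 'rV[R]_n).
  apply: measurable_fun_rowP => i.
  apply: (measurability _ (RGenInftyO.measurableE R)).
  move=> _ [_ [c ->] <-]; rewrite setTI.
  rewrite (_ : _ @^-1` _ = [set x : 'rV[R]_n | (x 0 i < c)%R]).
    exact: hausdorff_half_space.
  by apply/seteqP; split => x /=; rewrite in_itv.
by move=> mA; have := mid measurableT _ mA; rewrite setTI.
Qed.

Let hausdorff_sigma_additive m : semi_sigma_additive (@hausdorff R n m).
Proof.
move=> F mF tF mUF; apply: (@caratheodory_measure_sigma_additive _ _ (@hausdorff R n m)) => //.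
  by move=> k; exact: measurable_hausdorff_caratheodory.
exact: measurable_hausdorff_caratheodory.
Qed.

HB.instance Definition _ m := isMeasure.Build _ _ _ (@hausdorff R n m)
  (@hausdorff0 R n m) (@hausdorff_ge0 R n m) (@hausdorff_sigma_additive m).

End caratheodory.

Section radiative_transfer.
Context {R : realType} {d : nat}.
Local Notation E := 'rV[R]_d.
Implicit Types (D : set E) (n : E -> E) (u w phi h : E * E -> R).

Definition spatial_domain D : Prop := [/\ open D, connected D & D !=set0].

Definition boundary D : set E := closure D `\` interior D.

(* First-order approximation by a half space: near x, the domain contains the
   cone around - n x and avoids the cone around n x, for every aperture. As for
   Lipschitz domains, this is required at almost every boundary point only. *)
Definition outward_unit_normal D n : Prop :=
  measurable_fun (boundary D) n /\
  \forall x \ae @hausdorff R d d.-1, boundary D x ->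
    enorm (n x) = 1 /\
    forall e : R, 0 < e -> \forall y \near x,
      (dot (y - x) (n x) < - e * enorm (y - x) -> D y) /\
      (e * enorm (y - x) < dot (y - x) (n x) -> ~ closure D y).

Definition phase_space D : set (E * E) := D `*` sphere.

Definition phase_measure : set (E * E) -> \bar R :=
  (@lebesgue_row R d \x @sphere_measure R d)%E.
HB.instance Definition _ := Measure.on phase_measure.

Definition inflow D n : set (E * E) :=
  [set z | [/\ boundary D z.1, sphere z.2 & dot (n z.1) z.2 < 0]].

Definition boundary_measure : set (E * E) -> \bar R :=
  (@hausdorff R d d.-1 \x @sphere_measure R d)%E.
HB.instance Definition _ := Measure.on boundary_measure.

Definition L2_phase D u : Prop :=
  measurable_fun (phase_space D) u /\
  phase_measure.-integrable (phase_space D) (fun z => (u z ^+ 2)%:E).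

Definition sqnorm_phase D u : R :=
  \int[phase_measure]_(z in phase_space D) (u z ^+ 2).

Definition L2_inflow D n h : Prop :=
  measurable_fun (inflow D n) h /\
  boundary_measure.-integrable (inflow D n)
    (fun z => (h z ^+ 2 * `|dot (n z.1) z.2|)%:E).

Definition inner_inflow D n (h k : E * E -> R) : R :=
  \int[boundary_measure]_(z in inflow D n) (h z * k z * `|dot (n z.1) z.2|).

Definition test_function D phi : Prop :=
  [/\ continuous phi,
      forall z v, derivable (fun x => phi (x, z.2)) z.1 v,
      forall v, continuous (fun z : E * E => 'D_v (fun x => phi (x, z.2)) z.1) &
      exists K : set E, [/\ compact K, K `<=` D &
        forall z, ~ K z.1 -> phi z = 0]].

(* w represents the distribution omega . grad_x u on D x S^(d-1). *)
Definition weak_streaming D u w : Prop :=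
  (forall K : set E, compact K -> K `<=` D ->
    phase_measure.-integrable (K `*` sphere) (EFin \o w)) /\
  (forall phi, test_function D phi ->
    \int[phase_measure]_(z in phase_space D)
      (u z * 'D_(z.2) (fun x => phi (x, z.2)) z.1) =
    - \int[phase_measure]_(z in phase_space D) (w z * phi z)).

(* The weak derivative is unique up to a null set; an arbitrary representative
   is chosen. *)
Definition streaming D u : E * E -> R :=
  xget (cst 0) [set w | weak_streaming D u w].

Definition transport D (sigmaA : R) u : E * E -> R :=
  fun z => streaming D u z + sigmaA * u z.

Definition scattering (sigmaT : R) (p : R -> R) u : E * E -> R :=
  fun z => sigmaT * (u z - (fine (@sphere_measure R d sphere))^-1 *
    \int[@sphere_measure R d]_(w in sphere) (p (dot z.2 w) * u (z.1, w))).

Definition transport_scattering D (sigmaA sigmaT : R) (p : R -> R) u :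
    E * E -> R :=
  transport D sigmaA u \+ scattering sigmaT p u.

(* h is the trace of u on the inflow boundary: along almost every incoming
   characteristic, u (x + t omega, omega) has essential limit h (x, omega) as
   t -> 0+. Essential limits make this independent of the representative. *)
Definition is_trace D n u h : Prop :=
  measurable_fun (inflow D n) h /\
  \forall z \ae boundary_measure, inflow D n z ->
    forall e : R, 0 < e -> exists2 t0 : R, 0 < t0 &
      \forall t \ae @lebesgue_measure R, 0 < (t : R) < t0 ->
        `|u (z.1 + (t : R) *: z.2, z.2) - h z| < e.

Definition trace D n u : E * E -> R :=
  xget (cst 0) [set h | is_trace D n u h].

Definition C1_itv (a b : R) (f : R -> R) : Prop :=
  {within `[a, b], continuous f} /\
  exists2 f', {within `[a, b], continuous f'} &
    forall y, y \in `]a, b[ -> is_derive y 1 f (f' y).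

Definition phase_function (p : R -> R) : Prop :=
  [/\ C1_itv (-1) 1 p, (forall y, y \in `[-1, 1] -> 0 <= p y) &
      \int[@lebesgue_measure R]_(y in `[-1, 1]) p y = 1].

Definition V_space D n (sigmaA sigmaT : R) p : set (E * E -> R) :=
  [set u | [/\ L2_phase D u,
    exists w, weak_streaming D u w,
    L2_phase D (transport_scattering D sigmaA sigmaT p u) &
    exists2 h, is_trace D n u h & L2_inflow D n h]].

Definition V_norm D n (sigmaA sigmaT : R) p u : R :=
  Num.sqrt (sqnorm_phase D (transport_scattering D sigmaA sigmaT p u) +
            inner_inflow D n (trace D n u) (trace D n u)).

Definition bvp_solution D n (sigmaA sigmaT : R) p (g u : E * E -> R) : Prop :=
  [/\ V_space D n sigmaA sigmaT p u,
      \forall z \ae phase_measure, phase_space D z ->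
        transport_scattering D sigmaA sigmaT p u z = 0 &
      \forall z \ae boundary_measure, inflow D n z -> trace D n u z = g z].

Definition J D n (sigmaA sigmaT : R) p (gamma : R) (g u : E * E -> R) : R :=
  2^-1 * sqnorm_phase D (transport_scattering D sigmaA sigmaT p u) +
  gamma / 2 * inner_inflow D n (trace D n u \- g) (trace D n u \- g).

Definition Lagrangian D n (sigmaA sigmaT : R) p (gamma : R)
    (g u lambda : E * E -> R) : R :=
  J D n sigmaA sigmaT p gamma g u - inner_inflow D n lambda (trace D n u \- g).

Definition is_argmin (T : Type) (A : set T) (F : T -> R) (x : T) : Prop :=
  A x /\ forall y, A y -> F x <= F y.

Definition uzawa D n (sigmaA sigmaT : R) p (gamma rho : R) (g : E * E -> R)
    (u lambda : nat -> E * E -> R) : Prop :=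
  forall k,
    [/\ L2_inflow D n (lambda k),
        is_argmin (V_space D n sigmaA sigmaT p)
          (fun v => Lagrangian D n sigmaA sigmaT p gamma g v (lambda k)) (u k) &
        \forall z \ae boundary_measure, inflow D n z ->
          lambda k.+1 z = lambda k z - rho * (trace D n (u k) z - g z)].

End radiative_transfer.

(* Main.v *)
Require Import Defs.
From HB Require Import structures.
From mathcomp Require Import all_boot all_order all_algebra.
From mathcomp Require Import all_classical all_reals all_analysis measurable_realfun.
From mathcomp Require Import ring lra.
Set Implicit Arguments. Unset Strict Implicit. Unset Printing Implicit Defensive.
Import Order.TTheory GRing.Theory Num.Theory numFieldNormedType.Exports.
Local Open Scope classical_set_scope.
Local Open Scope ring_scope.

(* Write T for the transport-scattering operator and |.| for the weighted norm on
   the inflow boundary. Since T u* = 0 and u* = g on the inflow boundary, the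
   Lagrangian restricted to the line s u^k + (1 - s) u* is
     s^2 / 2 (||T u^k||^2 + gamma |u^k - g|^2) - s <lambda^k, u^k - g>,
   and its minimality at s = 1 gives
     ||T u^k||^2 + gamma |u^k - g|^2 = <lambda^k, u^k - g>.
   Expanding |lambda^{k+1}|^2 then yields
     |lambda^{k+1}|^2 = |lambda^k|^2 - 2 rho ||T u^k||^2 - rho (2 gamma - rho) |u^k - g|^2,
   so the nonnegative quantities subtracted at each step tend to 0; they control
   the V-norm of u^k - u*.
   The streaming derivative and the trace are chosen representatives, so linearity
   of T and of the trace only holds almost everywhere and rests on uniqueness: for
   the trace, of essential limits; for the weak derivative, of a locally integrable
   function orthogonal to all test functions, obtained from Dynkin's pi-lambda
   theorem on the pi-system of sets {q > 0} with q of class C^1 in x. *)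

(** * Borel sets of row vectors *)

Section borel_row.
Context {R : realType}.

Definition rat_row n (c : 'rV[rat]_n) : 'rV[R]_n := map_mx ratr c.

Lemma rat_row_dense n (x : 'rV[R]_n) (r : R) : 0 < r ->
  exists c : 'rV[rat]_n, forall i, `|rat_row c 0 i - x 0 i| < r.
Proof.
move=> r0.
have H i : exists c : rat, `|ratr c - x 0 i| < r.
  have [c] := @rat_in_itvoo R (x 0 i - r) (x 0 i + r) ltac:(lra).
  rewrite in_itv/= => /andP[c1 c2]; exists c.
  by rewrite ltr_norml; apply/andP; split; lra.
have [f hf] := choice H.
by exists (\row_i f i) => i; rewrite !mxE.
Qed.

Definition row_ball n (c : 'rV[R]_n) (r : R) : set 'rV[R]_n :=
  [set x | forall i, `|c 0 i - x 0 i| < r].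

Lemma measurable_row_ball n (c : 'rV[R]_n) (r : R) : measurable (row_ball c r).
Proof.
rewrite (_ : row_ball c r =
    \bigcap_(i in [set: 'I_n]) (fun x : 'rV[R]_n => x 0 i) @^-1` ball (c 0 i) r).
  apply: fin_bigcap_measurable => // i _.
  rewrite -[X in measurable X]setTI; apply: measurable_coord => //.
  exact: measurable_ball.
apply/seteqP; split => x /= H i; last exact: (H i I).
by move=> _; exact: H.
Qed.

Lemma ball_row_ball n (c : 'rV[R]_n) (r : R) : 0 < r -> ball c r = row_ball c r.
Proof.
move=> r0; apply/seteqP; split => x /=.
  by move=> [_ H] i; exact: H.
by move=> H; split => // i j; rewrite (ord1 i); exact: H.
Qed.

(** The product of two spaces of rows is second countable: [U] is the union of the products of
    rational sup-norm balls that it contains. A code [k] whose product is not contained in [U]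
    contributes [set0]. *)
Lemma open_measurable_rows n m (U : set ('rV[R]_n * 'rV[R]_m)) :
  open U -> measurable U.
Proof.
move=> oU.
pose F (k : 'rV[rat]_n * 'rV[rat]_m * rat) : set ('rV[R]_n * 'rV[R]_m) :=
  let B := row_ball (rat_row k.1.1) (ratr k.2) `*`
           row_ball (rat_row k.1.2) (ratr k.2) in
  if `[< B `<=` U >] then B else set0.
have -> : U = \bigcup_k F k.
  apply/seteqP; split => [z Uz|z [k _]]; last first.
    by rewrite /F; case: ifPn => // /asboolP; apply.
  have /nbhs_ballP[e /= e0 eU] := open_nbhs_nbhs (conj oU Uz).
  (* With centres within [q] of the components of [z], every point of the product is within
     [2 * q < e] of [z]. *)
  have [q] := @rat_in_itvoo R 0 (e / 2) ltac:(lra).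
  rewrite in_itv/= => /andP[q0 qe].
  have [c1 h1] := rat_row_dense z.1 q0.
  have [c2 h2] := rat_row_dense z.2 q0.
  exists (c1, c2, q) => //; rewrite /F/=.
  rewrite ifT; first by split.
  apply/asboolP => -[y1 y2] [/= hy1 hy2]; apply: eU.
  have D (a b c : R) : `|a - b| < ratr q -> `|a - c| < ratr q -> `|b - c| < e.
    rewrite !ltr_norml => /andP[? ?] /andP[? ?]; apply/andP; split; lra.
  split => /=.
    by rewrite ball_row_ball// => i; exact: D (h1 i) (hy1 i).
  by rewrite ball_row_ball// => i; exact: D (h2 i) (hy2 i).
apply: countable_bigcupT_measurable => [|k]; first exact: countableP.
rewrite /F; case: ifP => _ //; apply: measurableX; exact: measurable_row_ball.
Qed.

(** Reduced to the product case: [U] is the section at [0] of its preimage under the first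
    projection. *)
Lemma open_measurable_row n (U : set 'rV[R]_n) : open U -> measurable U.
Proof.
move=> oU.
have mU : measurable ((@fst 'rV[R]_n 'rV[R]_n) @^-1` U).
  apply: open_measurable_rows; apply: open_comp => // x _; exact: cvg_fst.
rewrite (_ : U = ysection (fst @^-1` U) (0 : 'rV[R]_n)).
  exact: measurable_ysection.
by apply/seteqP; split => x; rewrite /ysection/= inE.
Qed.

Lemma closed_measurable_row n (U : set 'rV[R]_n) : closed U -> measurable U.
Proof.
move=> cU; rewrite -(setCK U); apply: measurableC; apply: open_measurable_row.
exact: closed_openC.
Qed.

Lemma continuous_measurable_rows n m (f : 'rV[R]_n * 'rV[R]_m -> R) :
  continuous f -> measurable_fun setT f.
Proof.
move=> cf; apply: (measurability _ (RGenOpens.measurableE R)).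
move=> _ [_ [a [b ->] <-]]; rewrite setTI.
apply: open_measurable_rows; apply: open_comp; last exact: interval_open.
by move=> x _; exact: cf.
Qed.

Lemma measurable_boundary n (D : set 'rV[R]_n) : measurable (boundary D).
Proof.
apply: measurableD.
  by apply: closed_measurable_row; exact (@closed_closure _ D).
by apply: open_measurable_row; exact (@open_interior _ D).
Qed.

Lemma measurable_sphere n : measurable (@sphere R n).
Proof.
rewrite (_ : sphere = enorm @^-1` [set 1])//.
rewrite -[X in measurable X]setTI; exact: measurable_enorm.
Qed.

Lemma measurable_phase_space n (D : set 'rV[R]_n) : measurable D ->
  measurable (phase_space D).
Proof. by move=> mD; apply: measurableX => //; exact: measurable_sphere. Qed.

Lemma measurable_normal_dot n (D : set 'rV[R]_n) (nu : 'rV[R]_n -> 'rV[R]_n) :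
  measurable_fun (boundary D) nu ->
  measurable_fun (boundary D `*` [set: 'rV[R]_n]) (fun z => dot (nu z.1) z.2).
Proof.
move=> mnu; have mB : measurable (boundary D `*` [set: 'rV[R]_n]).
  by apply: measurableX => //; exact: measurable_boundary.
apply: measurable_sum => i; apply: measurable_funM.
  apply: (measurableT_comp (@measurable_coord _ _ n i)).
  apply: (measurable_comp (F := boundary D)) => //.
  - exact: measurable_boundary.
  - by move=> _ [[x y] [/= Dx _] <-].
  - exact: measurable_funTS.
apply: (measurableT_comp (@measurable_coord _ _ n i)).
exact: measurable_funTS.
Qed.

Lemma measurable_inflow n (D : set 'rV[R]_n) (nu : 'rV[R]_n -> 'rV[R]_n) :
  measurable_fun (boundary D) nu -> measurable (inflow D nu).
Proof.
move=> mnu.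
have -> : inflow D nu = (boundary D `*` sphere) `&`
    ((boundary D `*` setT) `&` (fun z => dot (nu z.1) z.2) @^-1` `]-oo, 0[).
  apply/seteqP; split => z /=; rewrite in_itv/=.
    by move=> [? ? ?]; split.
  by move=> [[? ?] [_ ?]].
apply: measurableI.
  apply: measurableX; [exact: measurable_boundary|exact: measurable_sphere].
have mB : measurable (boundary D `*` [set: 'rV[R]_n]).
  by apply: measurableX => //; exact: measurable_boundary.
exact: measurable_normal_dot.
Qed.

End borel_row.

(** * Integrable functions vanishing on a pi-system *)

Section pi_system.
Context d (T : measurableType d) (R : realType) (mu : {measure set T -> \bar R}).
Local Open Scope ereal_scope.

(** The measurable sets of zero charge for [induced_charge fi] form a Dynkin system, closed under
    complement because the whole space lies in [G]. By the pi-lambda theorem it contains every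
    measurable set, and an integrable function with all integrals zero vanishes almost
    everywhere. *)
Lemma integral_setI_closed_ae0 (G : set (set T)) (f : T -> \bar R) :
  mu.-integrable setT f -> G `<=` measurable -> measurable `<=` <<s G>> ->
  setI_closed G -> G setT -> (forall A, G A -> \int[mu]_(x in A) f x = 0) ->
  ae_eq mu setT f (cst 0).
Proof.
move=> fi Gm mG IG GT G0; apply: integral_ae_eq => // E _ mE.
rewrite [RHS]integral0.
have := mG _ mE; rewrite -setI_closed_g_dynkin_g_sigma_algebra//.
pose nu : {charge set T -> \bar R} := induced_charge fi.
suff dyn : dynkin [set A | measurable A /\ nu A = 0].
  move=> /(_ _)/(_ (conj dyn _)) [|//].
  by move=> A GA; split; [exact: Gm|exact: G0].
split.
- by split => //; exact: G0.
- move=> A [mA A0]; split; first exact: measurableC.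
  have := chargeU nu mA (measurableC mA) (setICr A).
  by rewrite setUCr A0 add0e /= => <-; exact: G0.
- move=> F tF /all_and2[mF F0]; split; first exact: bigcupT_measurable.
  have := @charge_semi_sigma_additive _ _ _ nu F mF tF (bigcupT_measurable F mF).
  under eq_fun do rewrite big1//.
  by move=> /cvg_lim <- //; rewrite lim_cst.
Qed.

End pi_system.

(** * Functions of class C^1 in the space variable *)

Section C1x.
Context {R : realType} {n : nat}.
Local Notation E := 'rV[R]_n.
Implicit Types q : E * E -> R.

(** Turns directional derivatives into derivatives on the real line, where the chain rule and the
    mean value theorem apply. *)
Lemma is_derive_line (V : normedModType R) (f : V -> R) x v df :
  is_derive x v f df <-> is_derive (0 : R) 1 (fun h : R => f (h *: v + x)) df.
Proof.
suff H : (fun h : R => h^-1 *: ((f \o shift x) (h *: v) - f x)) =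
    (fun h : R => h^-1 *: (((fun h : R => f (h *: v + x)) \o shift 0) (h *: 1) -
       (fun h : R => f (h *: v + x)) 0)).
  by split=> -[d1 d2]; constructor; move: d1 d2;
    rewrite /derivable /derive H.
by rewrite funeqE => h /=; rewrite addr0 scale0r add0r [_%:A]mulr1.
Qed.

Lemma is_derive_comp1 (V : normedModType R) (f : V -> R) (h : R -> R) x v a b :
  is_derive (f x) 1 h a -> is_derive x v f b ->
  is_derive x v (h \o f) (a * b).
Proof.
move=> dh /is_derive_line df; apply/is_derive_line.
have {}dh : is_derive ((fun t : R => f (t *: v + x)) 0) 1 h a.
  by rewrite scale0r add0r.
exact: is_derive1_comp dh df.
Qed.

(** The regularity clauses of [test_function] without the support condition; unlike test functions,
    this class contains the constants and the coordinates. *)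
Definition C1x q : Prop :=
  [/\ continuous q, forall z v, derivable (fun x => q (x, z.2)) z.1 v &
   forall v, continuous (fun z : E * E => 'D_v (fun x => q (x, z.2)) z.1)].

Lemma C1xP q (dq : E -> E * E -> R) : continuous q ->
  (forall z v, is_derive z.1 v (fun x => q (x, z.2)) (dq v z)) ->
  (forall v, continuous (dq v)) -> C1x q.
Proof.
move=> cq hq cdq; split => // v.
rewrite (_ : (fun _ => _) = dq v)//.
by apply/funext => z; have [] := hq z v.
Qed.

Lemma C1x_cst (c : R) : C1x (cst c).
Proof.
apply: (@C1xP _ (fun _ => cst 0)).
- by move=> z; exact: cvg_cst.
- by move=> z v; exact: is_derive_cst.
- by move=> v z; exact: cvg_cst.
Qed.

Lemma C1xM q1 q2 : C1x q1 -> C1x q2 -> C1x (q1 \* q2).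
Proof.
move=> [c1 d1 e1] [c2 d2 e2].
apply: (@C1xP _ (fun v z => q1 z * 'D_v (fun x => q2 (x, z.2)) z.1 +
   q2 z * 'D_v (fun x => q1 (x, z.2)) z.1)).
- by move=> z; apply: cvgM; [exact: c1|exact: c2].
- move=> [x y] v; exact: (is_deriveM (derivableP (d1 (x, y) v)) (derivableP (d2 (x, y) v))).
- move=> v z; apply: cvgD.
    by apply: cvgM; [exact: c1|exact: e2].
  by apply: cvgM; [exact: c2|exact: e1].
Qed.

Lemma C1xB q1 q2 : C1x q1 -> C1x q2 -> C1x (q1 \- q2).
Proof.
move=> [c1 d1 e1] [c2 d2 e2].
apply: (@C1xP _ (fun v z => 'D_v (fun x => q1 (x, z.2)) z.1 -
   'D_v (fun x => q2 (x, z.2)) z.1)).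
- by move=> z; apply: cvgB; [exact: c1|exact: c2].
- move=> [x y] v; exact: (is_deriveB (derivableP (d1 (x, y) v)) (derivableP (d2 (x, y) v))).
- move=> v z; by apply: cvgB; [exact: e1|exact: e2].
Qed.

Lemma C1xD q1 q2 : C1x q1 -> C1x q2 -> C1x (q1 \+ q2).
Proof.
move=> h1 h2; have := C1xB h1 (C1xB (C1x_cst 0) h2).
by congr C1x; apply/funext => z /=; rewrite sub0r opprK.
Qed.

Lemma C1x_comp (h h' : R -> R) q :
  (forall s : R, is_derive s (1 : R) h (h' s)) -> continuous h' -> C1x q -> C1x (h \o q).
Proof.
move=> dh ch' [cq d1 e1].
apply: (@C1xP _ (fun v z => h' (q z) * 'D_v (fun x => q (x, z.2)) z.1)).
- move=> z; apply: continuous_comp; first exact: cq.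
  by apply/differentiable_continuous/derivable1_diffP; have [] := dh (q z).
- by move=> [x y] v; apply: is_derive_comp1; exact: (derivableP (d1 (x, y) v)).
- move=> v z; apply: cvgM; last exact: e1.
  by apply: continuous_comp; [exact: cq|exact: ch'].
Qed.

Lemma C1x_fst i : C1x (fun z => z.1 0 i).
Proof.
apply: (@C1xP _ (fun v => cst (v 0 i))).
- move=> z; apply: (continuous_comp (f := fst) (g := fun x : E => x 0 i)).
    exact: cvg_fst.
  exact: coord_continuous.
- move=> [x y] v /=; apply/is_derive_line.
  rewrite (_ : (fun _ => _) = (fun h : R => h * v 0 i + x 0 i)).
    by apply: is_derive_eq; rewrite addr0 scaler0 add0r [_%:A]mulr1.
  by apply/funext => h; rewrite !mxE.
- by move=> v z; exact: cvg_cst.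
Qed.

Lemma C1x_snd i : C1x (fun z => z.2 0 i).
Proof.
apply: (@C1xP _ (fun v => cst 0)).
- move=> z; apply: (continuous_comp (f := snd) (g := fun x : E => x 0 i)).
    exact: cvg_snd.
  exact: coord_continuous.
- by move=> [x y] v /=; exact: is_derive_cst.
- by move=> v z; exact: cvg_cst.
Qed.

(** The squared positive part is of class C^1, unlike the positive part itself, and is positive
    exactly where [s] is. *)
Definition sqpos (s : R) : R := (Num.max s 0) ^+ 2.

Lemma sqpos_ge0 s : 0 <= sqpos s. Proof. exact: sqr_ge0. Qed.

Lemma sqpos_gt0 s : (0 < sqpos s) = (0 < s).
Proof.
rewrite /sqpos exprn_even_gt0//=; case: (leP s 0) => s0; first by rewrite eqxx.
by rewrite gt_eqF.
Qed.

Lemma is_derive_sqpos (s : R) : is_derive s (1 : R) sqpos (2 * Num.max s 0).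
Proof.
suff H : (fun h : R => h^-1 *: ((sqpos \o shift s) (h *: 1) - sqpos s)) @ 0^' -->
    2 * Num.max s 0.
  by constructor; [apply/cvg_ex; eexists; exact: H|exact: cvg_lim H].
apply/cvgrPdist_lt => e e0; near=> h.
have h0 : h != 0 by near: h; exact: nbhs_dnbhs_neq.
have he : `|h| < e.
  near: h; apply: (@dnbhs0_lt R R); exact: e0.
apply: le_lt_trans he.
rewrite /= [_%:A]mulr1 /GRing.scale/=.
(* The difference quotient is within [|h|] of the derivative: multiplied by [|h|], this is a
   polynomial inequality with right-hand side [h ^+ 2] for each choice of the signs of [s] and
   [h + s]. *)
rewrite -(ler_pM2l (_ : 0 < `|h|)) ?normr_gt0// -normrM mulrBr.
rewrite [h * (h^-1 * _)]mulrA divff// mul1r.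
rewrite -[leRHS]normrM -expr2 (ger0_norm (sqr_ge0 h)) /sqpos.
by rewrite ler_norml; case: (leP s 0) => ?; case: (leP (h + s) 0) => ?;
  apply/andP; split; nra.
Unshelve. all: by end_near. Qed.

(* As m grows, cutoff m \o q converges to the indicator of {q > 0}. *)
Definition cutoff (m s : R) : R := 1 - (1 + m * sqpos s)^-1.

Lemma cutoff_den_ge1 m s : 0 <= m -> 1 <= 1 + m * sqpos s.
Proof. by move=> m0; rewrite lerDl mulr_ge0 ?sqpos_ge0. Qed.

Lemma cutoff_ge0 m s : 0 <= m -> 0 <= cutoff m s.
Proof.
move=> m0; have h := cutoff_den_ge1 s m0; rewrite /cutoff subr_ge0 invf_le1//.
exact: lt_le_trans h.
Qed.

Lemma cutoff_le1 m s : 0 <= m -> cutoff m s <= 1.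
Proof.
move=> m0; have h := cutoff_den_ge1 s m0; rewrite /cutoff gerBl invr_ge0.
exact: le_trans h.
Qed.

Lemma cutoff_le0 m s : s <= 0 -> cutoff m s = 0.
Proof.
move=> s0; have : ~~ (0 < sqpos s) by rewrite sqpos_gt0 -leNgt.
rewrite lt_neqAle sqpos_ge0 andbT negbK => /eqP s0'.
by rewrite /cutoff -s0' mulr0 addr0 invr1 subrr.
Qed.

Lemma cutoff_cvg s : 0 < s -> cutoff k%:R s @[k --> \oo] --> (1 : R).
Proof.
rewrite -sqpos_gt0 /cutoff; move: (sqpos s) => t t0.
rewrite -[X in _ --> X]subr0; apply: cvgB; first exact: cvg_cst.
apply/cvgrPdist_lt => e e0; near=> k.
have k0 : 0 <= k%:R :> R by [].
rewrite sub0r normrN ger0_norm; last by rewrite invr_ge0 addr_ge0// mulr_ge0// ltW.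
rewrite invf_plt ?posrE//; last by rewrite ltr_wpDr// mulr_ge0// ltW.
have : e^-1 / t < k%:R by near: k; exact: nbhs_infty_gtr.
by rewrite ltr_pdivrMr// => /lt_le_trans; apply; rewrite lerDr.
Unshelve. all: by end_near. Qed.

Lemma C1x_cutoff m q : 0 <= m -> C1x q -> C1x (cutoff m \o q).
Proof.
move=> m0.
have den s : 1 + m * sqpos s != 0.
  by rewrite gt_eqF// (lt_le_trans _ (cutoff_den_ge1 s m0)).
apply: (@C1x_comp _ (fun s => (1 + m * sqpos s) ^- 2 * (m * (2 * Num.max s 0)))).
  move=> s; have ds := is_derive_sqpos s.
  have dd : is_derive s (1 : R) (fun s => 1 + m * sqpos s) (m * (2 * Num.max s 0)).
    have := is_deriveD (is_derive_cst (1 : R) s (1 : R)) (is_deriveZ m ds).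
    by rewrite add0r.
  have := is_deriveB (is_derive_cst (1 : R) s (1 : R))
    (is_deriveV (f := fun s => 1 + m * sqpos s) (den s) dd).
  by rewrite sub0r scaleNr opprK.
have cs : continuous sqpos.
  move=> s; apply/differentiable_continuous/derivable1_diffP.
  by have [] := is_derive_sqpos s.
move=> s; apply: cvgM; last first.
  apply: cvgM; first exact: cvg_cst.
  apply: cvgM; first exact: cvg_cst.
  by apply: continuous_max; [exact: cvg_id|exact: cvg_cst].
apply: cvgV; first by rewrite expf_neq0.
have cd : {for s, continuous (fun s => 1 + m * sqpos s)}.
  apply: cvgD; first exact: cvg_cst.
  by apply: cvgM; [exact: cvg_cst|exact: cs].
by rewrite expr2; apply: cvgM; exact: cd.
Qed.

Lemma C1x_sqpos q : C1x q -> C1x (sqpos \o q).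
Proof.
apply: C1x_comp; first exact: is_derive_sqpos.
move=> s; apply: cvgM; first exact: cvg_cst.
by apply: continuous_max; [exact: cvg_id|exact: cvg_cst].
Qed.

End C1x.

(** * Euclidean balls *)

Section enorm_ball.
Context {R : realType} {n : nat}.
Local Notation E := 'rV[R]_n.

Lemma dot_ge0 (x : E) : 0 <= dot x x.
Proof. by rewrite sumr_ge0// => i _; rewrite -expr2 sqr_ge0. Qed.

Lemma sqr_enorm (x : E) : enorm x ^+ 2 = dot x x.
Proof. by rewrite sqr_sqrtr// dot_ge0. Qed.

(** The crude factor [n.+1] replaces the square root of [n]; it is nonzero in every dimension, so a
    tolerance can be divided by it. *)
Lemma enorm_le (x : E) (e : R) : (forall i, `|x 0 i| <= e) -> 0 <= e ->
  enorm x <= n.+1%:R * e.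
Proof.
move=> xe e0; rewrite -(ger0_norm (_ : 0 <= n.+1%:R * e)) ?mulr_ge0//.
rewrite -sqrtr_sqr ler_sqrt ?sqr_ge0// /dot exprMn.
apply: (@le_trans _ _ (\sum_(i < n) e ^+ 2)).
  apply: ler_sum => i _; rewrite -expr2 -(real_normK (num_real (x 0 i))).
  by rewrite ler_sqr ?nnegrE.
rewrite sumr_const card_ord -[leLHS]mulr_natl ler_wpM2r ?sqr_ge0//.
by rewrite -natrX ler_nat (@leq_trans n.+1)// -mulnn leq_pmulr.
Qed.

(** Euclidean balls are described by the squared distance, a polynomial in the coordinates and hence
    of class [C1x], whereas [enorm] is not smooth at [0]. *)
Definition closed_ball_enorm (c : E) (r : R) : set E :=
  [set x | dot (x - c) (x - c) <= r ^+ 2].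

Definition open_ball_enorm (c : E) (r : R) : set E :=
  [set x | dot (x - c) (x - c) < r ^+ 2].

Lemma closed_ball_enorm_coord c r x i : 0 <= r -> closed_ball_enorm c r x ->
  `|x 0 i - c 0 i| <= r.
Proof.
move=> r0 xr; apply: (@le_trans _ _ (enorm (x - c))).
  by have := coord_le_enorm (x - c) i; rewrite !mxE.
rewrite -(ger0_norm r0) -sqrtr_sqr /enorm ler_sqrt//; exact: sqr_ge0.
Qed.

Lemma C1x_sqdist (c : E) : C1x (fun z : E * E => dot (z.1 - c) (z.1 - c)).
Proof.
rewrite /dot; elim: (index_enum _) => [|i s ih].
  rewrite (_ : (fun _ => _) = cst 0); first exact: C1x_cst.
  by apply/funext => z; rewrite big_nil.
rewrite (_ : (fun _ => _) = (((fun z : E * E => z.1 0 i) \- cst (c 0 i)) \*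
   ((fun z : E * E => z.1 0 i) \- cst (c 0 i))) \+
   (fun z => \sum_(i <- s) (z.1 - c) 0 i * (z.1 - c) 0 i)).
  apply: C1xD => //; apply: C1xM; apply: C1xB;
    first [exact: C1x_fst|exact: C1x_cst].
by apply/funext => z; rewrite big_cons/= !mxE.
Qed.

Lemma C1x_ball (c : E) (r : R) :
  C1x (fun z : E * E => r ^+ 2 - dot (z.1 - c) (z.1 - c)).
Proof.
exact: (@C1xB _ _ (cst (r ^+ 2)) _ (@C1x_cst _ _ _) (C1x_sqdist c)).
Qed.

Lemma continuous_dot_sub (c : E) : continuous (fun x : E => dot (x - c) (x - c)).
Proof.
have [h _ _] := C1x_sqdist c.
move=> x; apply: (@continuous_comp _ _ _ (fun y : E => (y, y))
  (fun z : E * E => dot (z.1 - c) (z.1 - c))).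
  move=> P [[A B] /= [hA hB] sub]; apply: filterS2 hA hB => y Ay By.
  exact: (sub (y, y)).
exact: h.
Qed.

Lemma compact_closed_ball_enorm (c : E) r : 0 <= r -> compact (closed_ball_enorm c r).
Proof.
move=> r0; apply: bounded_closed_compact; last first.
  apply: (closed_comp (f := fun x : E => dot (x - c) (x - c))
     (D := [set t | t <= r ^+ 2])).
    by move=> x _; exact: continuous_dot_sub.
  exact: closed_le.
exists (r + `|c|); split; first exact: num_real.
move=> M rM x xB /=; apply: ltW; apply: le_lt_trans rM.
rewrite -(subrK c x); apply: le_trans (ler_normD _ _) _; rewrite lerD2r.
rewrite [leLHS]/Num.norm/= mx_normrE; apply/bigmax_leP; split => // -[i j] _ /=.
by rewrite (ord1 i) !mxE; exact: closed_ball_enorm_coord.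
Qed.

Lemma compact_sphere : compact (@sphere R n).
Proof.
apply: (@subclosed_compact _ _ (closed_ball_enorm 0 1)).
- rewrite (_ : sphere = (fun x : E => dot (x - 0) (x - 0)) @^-1` [set 1]).
    apply: closed_comp; first by move=> x _; exact: continuous_dot_sub.
    exact: closed_eq.
  apply/seteqP; split => x; rewrite /sphere/= subr0 /=.
    by rewrite -sqr_enorm => ->; rewrite expr1n.
  by rewrite /enorm => ->; rewrite sqrtr1.
- by apply: compact_closed_ball_enorm.
- by move=> x; rewrite /sphere/closed_ball_enorm/= subr0 -sqr_enorm => ->.
Qed.

Lemma measurable_compact_row (K : set E) : compact K -> measurable K.
Proof.
by move=> cK; apply: closed_measurable_row; exact: compact_closed.
Qed.

Lemma measurable_compact_sphere (K : set E) : compact K ->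
  measurable (K `*` @sphere R n).
Proof.
move=> cK; apply: measurableX; last exact: measurable_sphere.
exact: measurable_compact_row.
Qed.

(** The balls have rational centres and radii, enumerated by [unpickle]. An index that decodes to
    nothing, or to a ball that is not [good], gets radius [0]: its open ball is empty, while its
    closed ball is a point that may lie outside [D], whence the alternative [r k = 0]. *)
Lemma open_ball_cover (D : set E) : open D ->
  exists c : nat -> E, exists r : nat -> R,
    [/\ forall k, 0 <= r k,
        forall k, closed_ball_enorm (c k) (r k) `<=` D \/ r k = 0 &
        D = \bigcup_k open_ball_enorm (c k) (r k)].
Proof.
move=> oD.
pose good (k : 'rV[rat]_n * rat) :=
  0 <= ratr k.2 :> R /\ closed_ball_enorm (rat_row k.1) (ratr k.2) `<=` D.
pose c (k : nat) : E :=
  if @unpickle ('rV[rat]_n * rat)%type k is Some i then rat_row i.1 else 0.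
pose r (k : nat) : R := if @unpickle ('rV[rat]_n * rat)%type k is Some i then
   (if `[< good i >] then ratr i.2 else 0) else 0.
have sub k : open_ball_enorm (c k) (r k) `<=` D.
  rewrite /c /r; case: unpickle => [i|].
    case: ifPn => [/asboolP[_ gi]|_] x; first by move=> /ltW; exact: gi.
    by rewrite /open_ball_enorm/= expr0n/= ltNge dot_ge0.
  by move=> x; rewrite /open_ball_enorm/= expr0n/= ltNge dot_ge0.
exists c, r; split => //.
- by move=> k; rewrite /r; case: unpickle => // i; case: ifPn => // /asboolP[].
- move=> k; rewrite /c /r; case: unpickle => [i|]; last by right.
  by case: ifPn => [/asboolP[_ gi]|_]; [left|right].
apply/seteqP; split => [x Dx|x [k _]]; last exact: sub.
have /nbhs_ballP[e /= e0 eD] := open_nbhs_nbhs (conj oD Dx).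
(* The centre will be within [e / 3] of [x] in Euclidean norm, so a radius above [e / 3] captures
   [x]; a radius below [e / 2] keeps the closed ball in [D], as [e / 3 + e / 2 < e]. *)
have [q] := @rat_in_itvoo R (e / 3) (e / 2) ltac:(lra).
rewrite in_itv/= => /andP[q1 q2].
have q0 : 0 < ratr q :> R by lra.
pose dlt := e / (3 * n.+1%:R).
have dlt0 : 0 < dlt by rewrite divr_gt0// mulr_gt0.
have [a ha] := rat_row_dense x dlt0.
have dlte : n.+1%:R * dlt = e / 3.
  have : n.+1%:R != 0 :> R by rewrite pnatr_eq0.
  by rewrite /dlt; move: (n.+1%:R : R) => N N0; field.
have dlte' : dlt <= e / 3.
  by rewrite -dlte ler_peMl ?(ltW dlt0)// ler1n.
have gi : good (a, q).
  split => /=; first exact: ltW.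
  move=> y /(closed_ball_enorm_coord _ (ltW q0)) yq.
  apply: eD; rewrite ball_row_ball// => i.
  have := yq i; have := ha i; rewrite !ler_norml !ltr_norml.
  by move=> /andP[? ?] /andP[? ?]; apply/andP; split; lra.
exists (pickle (a, q)) => //; rewrite /c /r pickleK.
rewrite ifT; last exact/asboolP.
rewrite /open_ball_enorm/= -sqr_enorm ltr_sqr ?nnegrE ?sqrtr_ge0 ?ltW//.
apply: le_lt_trans q1; rewrite -dlte; apply: enorm_le; last exact: ltW.
by move=> i; rewrite !mxE distrC; have := ha i; rewrite !mxE => /ltW.
Qed.

End enorm_ball.

(** * Uniqueness of weak derivatives *)

Section support.
Context d (T : measurableType d) (R : realType) (mu : {measure set T -> \bar R}).
Local Open Scope ereal_scope.
Implicit Types (A B : set T) (f : T -> \bar R).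

Lemma patch_support A B f : A `<=` B -> (forall x, B x -> ~ A x -> f x = 0) ->
  f \_ A = f \_ B.
Proof.
move=> AB f0; apply/funext => x; rewrite !patchE.
have [xA|xA] := boolP (x \in A).
  by rewrite ifT// inE; apply: AB; rewrite inE in xA.
case: ifPn => // xB; rewrite f0//; first by rewrite inE in xB.
by move: xA; rewrite notin_setE.
Qed.

Lemma integrable_support A B f : measurable A -> measurable B -> A `<=` B ->
  (forall x, B x -> ~ A x -> f x = 0) ->
  mu.-integrable A f -> mu.-integrable B f.
Proof.
move=> mA mB AB f0 /(integrable_mkcond _ mA) fA; apply/(integrable_mkcond _ mB).
by rewrite -(patch_support AB f0).
Qed.

Lemma integral_support A B f : A `<=` B -> (forall x, B x -> ~ A x -> f x = 0) ->
  \int[mu]_(x in A) f x = \int[mu]_(x in B) f x.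
Proof.
by move=> AB f0; rewrite integral_mkcond (patch_support AB f0) -integral_mkcond.
Qed.

End support.

Section weak_derivative_unique.
Context {R : realType} {n : nat}.
Local Notation E := 'rV[R]_n.
Implicit Types (D K : set E) (c : E) (r : R) (w phi u : E * E -> R).

Definition locally_integrable D w := forall K : set E, compact K -> K `<=` D ->
  (@phase_measure R n).-integrable (K `*` sphere) (EFin \o w).

Lemma bounded_on_compact_sphere K phi : continuous phi -> compact K ->
  [bounded phi z | z in K `*` @sphere R n].
Proof.
move=> cphi cK.
have := compact_bounded (continuous_compact
  (continuous_subspaceT cphi) (compact_setX cK (@compact_sphere R n))).
by move=> [M [Mr H]]; exists M; split => // x /H {}H z zK; apply: H; exists z.
Qed.

Lemma integrable_mul_test D w phi : open D -> locally_integrable D w ->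
  test_function D phi ->
  (@phase_measure R n).-integrable (phase_space D) (fun z => (w z * phi z)%:E).
Proof.
move=> oD wi [cphi _ _ [K [cK KD phi0]]].
have mK := measurable_compact_sphere cK.
apply: (integrable_support mK).
- by apply: measurable_phase_space; exact: open_measurable_row.
- by move=> z [/= /KD Dz Sz].
- move=> z [_ Sz] nK; rewrite phi0 ?mulr0// => Kz; exact: nK.
apply: (integrableMl mK (wi K cK KD)) => //.
  by apply: measurable_funTS; exact: continuous_measurable_rows.
exact: bounded_on_compact_sphere.
Qed.

(** The pi-lambda argument is applied to [w] cut off to the ball times the sphere. The integral of
    [w] over the part of this set where [q > 0] is a limit of integrals of [w] against test
    functions, all of which are zero. *)
Lemma weak_zero_ball D w c r : open D -> locally_integrable D w ->
  (forall phi, test_function D phi ->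
    \int[@phase_measure R n]_(z in phase_space D) (w z * phi z) = 0) ->
  0 <= r -> closed_ball_enorm c r `<=` D ->
  \forall z \ae @phase_measure R n,
    open_ball_enorm c r z.1 -> sphere z.2 -> w z = 0.
Proof.
move=> oD wi w0 r0 KD.
have cK := compact_closed_ball_enorm (c := c) r0.
set K := closed_ball_enorm c r in KD cK.
have mK := measurable_compact_sphere cK.
have wK := wi K cK KD.
pose q0 (z : E * E) := r ^+ 2 - dot (z.1 - c) (z.1 - c).
have q0E z : (0 < q0 z) = (dot (z.1 - c) (z.1 - c) < r ^+ 2) by rewrite subr_gt0.
have Cq0 : C1x q0 by exact: C1x_ball.
pose B : set (E * E) := [set z | 0 < q0 z] `&` (K `*` sphere).
have mpos (q : E * E -> R) : C1x q -> measurable [set z | 0 < q z].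
  move=> [cq _ _]; apply: open_measurable_rows.
  rewrite (_ : [set z | _] = q @^-1` [set t | 0 < t])//.
  by apply: open_comp; [move=> x _; exact: cq|exact: open_gt].
have mB : measurable B by apply: measurableI => //; exact: mpos.
pose f := (EFin \o w) \_ B.
have fi : (@phase_measure R n).-integrable setT f.
  by apply/(integrable_mkcond _ mB); apply: integrableS wK => //; exact: subIsetr.
pose G := [set A : set (E * E) | exists2 q, C1x q & A = [set z | 0 < q z]].
have : ae_eq (@phase_measure R n) setT f (cst 0%E).
  apply: (integral_setI_closed_ae0 (G := G)) fi _ _ _ _ _.
  - by move=> _ [q Cq ->]; exact: mpos.
  (* [G] generates the Borel sets: a half-space bounding one coordinate below is the positivity set
     of an affine function, so the identity out of the sigma-algebra generated by [G] is
     measurable. *)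
  - have mid : measurable_fun [set: g_sigma_algebraType G]
        (id : g_sigma_algebraType G -> E * E).
      apply/measurable_fun_pairP; split; apply: measurable_fun_rowP => i;
        apply: (measurability _ (RGenOInfty.measurableE R));
        move=> _ [_ [a ->] <-]; rewrite setTI; apply: sub_sigma_algebra.
        exists ((fun z : E * E => z.1 0 i) \- cst a).
          by apply: C1xB; [exact: C1x_fst|exact: C1x_cst].
        by apply/seteqP; split => z /=; rewrite in_itv/= andbT subr_gt0.
      exists ((fun z : E * E => z.2 0 i) \- cst a).
        by apply: C1xB; [exact: C1x_snd|exact: C1x_cst].
      by apply/seteqP; split => z /=; rewrite in_itv/= andbT subr_gt0.
    by move=> A mA; have := mid measurableT _ mA; rewrite setTI.
  - move=> _ _ [q1 C1 ->] [q2 C2 ->].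
    (* The plain product [q1 * q2] would also be positive where both factors are negative. *)
    exists ((sqpos \o q1) \* (sqpos \o q2)); first by apply: C1xM; exact: C1x_sqpos.
    apply/seteqP; split => z /=.
      by move=> [? ?]; rewrite mulr_gt0 ?sqpos_gt0.
    rewrite lt_neqAle => /andP[]; rewrite eq_sym mulf_eq0 negb_or => /andP[h1 h2] _.
    by split; rewrite -sqpos_gt0 lt_neqAle eq_sym ?h1 ?h2 sqpos_ge0.
  - exists (cst 1); first exact: C1x_cst.
    by apply/seteqP; split => z /=.
  move=> _ [q Cq ->].
  (* The factor with [q0] confines the support to the compact ball [K], so that [phi m] is a test
     function even though [q] has no support condition. *)
  pose Q := (sqpos \o q0) \* (sqpos \o q).
  have CQ : C1x Q by apply: C1xM; exact: C1x_sqpos.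
  pose phi (m : nat) := cutoff m%:R \o Q.
  have Cphi m : C1x (phi m) by exact: C1x_cutoff.
  have QE z : (0 < Q z) = (0 < q0 z) && (0 < q z).
    rewrite -[in RHS](sqpos_gt0 (q0 z)) -[in RHS](sqpos_gt0 (q z)) /Q/=.
    apply/idP/andP => [|[h1 h2]]; last exact: mulr_gt0.
    rewrite lt_neqAle => /andP[]; rewrite eq_sym mulf_eq0 negb_or => /andP[h1 h2] _.
    by split; rewrite lt_neqAle eq_sym ?h1 ?h2 sqpos_ge0.
  have phiout m z : ~ K z.1 -> phi m z = 0.
    move=> nKz; apply: cutoff_le0; rewrite leNgt QE q0E; apply/negP => /andP[h _].
    by apply: nKz; exact: ltW.
  have test m : test_function D (phi m).
    by have [? ? ?] := Cphi m; split => //; exists K; split => // z; exact: phiout.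
  pose ind : set (E * E) := [set z | 0 < Q z].
  have mind : measurable ind by exact: mpos.
  have int0 m : (\int[@phase_measure R n]_(z in K `*` sphere) (w z * phi m z)%:E = 0)%E.
    rewrite (@integral_support _ _ _ _ _ (phase_space D)).
    (* The hypothesis concerns the real-valued integral, which is [0] also for an infinite extended
       one; integrability makes the two agree. *)
    - have h := integrable_mul_test oD wi (test m).
      have mD : measurable (phase_space D).
        by apply: measurable_phase_space; exact: open_measurable_row.
      by rewrite -(fineK (integrable_fin_num mD h)); congr EFin; exact: w0.
    - by move=> z [/= /KD Dz Sz].
    - by move=> z [_ Sz] nK; rewrite phiout ?mulr0// => Kz; exact: nK.
  have mw : measurable_fun (K `*` @sphere R n) w.
    by apply/measurable_EFinP; exact: measurable_int wK.
  (* Since [0 <= phi m <= 1], the function [|w|], integrable on [K] times the sphere, dominates. *)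
  have [] := @dominated_convergence _ _ _ (@phase_measure R n) _ mK
    (fun m z => (w z * phi m z)%:E) (fun z => (w z * \1_ind z)%:E) (fun z => `|(w z)%:E|%E).
  - move=> m; apply/measurable_EFinP/measurable_funM => //.
    by apply: measurable_funTS; apply: continuous_measurable_rows; have [] := Cphi m.
  - by apply/measurable_EFinP/measurable_funM.
  - apply/aeW => z _; apply: cvg_EFin; first exact: nearW.
    apply: cvgM; first exact: cvg_cst.
    rewrite indicE; have [zi|zi] := boolP (z \in ind).
      by apply: cutoff_cvg; rewrite inE in zi.
    rewrite (_ : (fun _ => _) = cst 0); first exact: cvg_cst.
    apply/funext => m; apply: cutoff_le0; rewrite leNgt.
    by move: zi; rewrite notin_setE => /negP.
  - exact: integrable_abse.
  - apply/aeW => z m _; rewrite /= lee_fin normrM ler_piMr//.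
    by rewrite ger0_norm ?cutoff_le1 ?cutoff_ge0.
  move=> _ _; under eq_fun do rewrite int0.
  move=> /cvg_lim; rewrite lim_cst// => /(_ (@ereal_hausdorff _)) wind.
  (* Both sides become integrals over the whole space of the same function, compared by cases on the
     three membership conditions. *)
  rewrite [RHS]wind integral_mkcond [in RHS]integral_mkcond.
  congr (integral _ _ _); apply/funext => z; rewrite /f !patchE indicE.
  rewrite [z \in ind](_ : _ = (0 < q0 z) && (0 < q z)); last first.
    by rewrite -QE; apply/idP/idP; rewrite inE.
  rewrite [z \in [set _ | _]](_ : _ = (0 < q z)); last by apply/idP/idP; rewrite inE.
  rewrite [z \in B](_ : _ = (0 < q0 z) && (z \in K `*` sphere)); last first.
    by rewrite in_setI; congr (_ && _); apply/idP/idP; rewrite inE.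
  case: (0 < q z); case: (0 < q0 z); case: (z \in K `*` sphere) => //=;
    by rewrite ?mulr1 ?mulr0.
apply: filterS => z /(_ I); rewrite /f patchE => + Bz Sz.
rewrite ifT; first by move=> /= [].
rewrite inE; split; first by rewrite /= q0E.
by split => //; exact: ltW.
Qed.

(** Countably many balls cover [D], so their exceptional null sets can be discarded together. *)
Lemma weak_zero D w : open D -> locally_integrable D w ->
  (forall phi, test_function D phi ->
    \int[@phase_measure R n]_(z in phase_space D) (w z * phi z) = 0) ->
  \forall z \ae @phase_measure R n, phase_space D z -> w z = 0.
Proof.
move=> oD wi w0.
have [c [r [r0 rD DE]]] := open_ball_cover oD.
have : \forall z \ae @phase_measure R n, forall k,
    open_ball_enorm (c k) (r k) z.1 -> sphere z.2 -> w z = 0.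
  apply: ae_foralln => k; case: (rD k) => [kD|rk].
    exact: weak_zero_ball oD wi w0 (r0 k) kD.
  by apply: aeW => z; rewrite rk /open_ball_enorm/= expr0n/= ltNge dot_ge0.
apply: filterS => z H [+ Sz]; rewrite {1}DE => -[k _ kz]; exact: H kz Sz.
Qed.

(** Measurability is known on compact sets times the sphere, and is glued along the countable cover
    of [D] by balls. *)
Lemma locally_integrable_measurable D w : open D -> locally_integrable D w ->
  measurable_fun (phase_space D) w.
Proof.
move=> oD wi; have [c [r [r0 rD DE]]] := open_ball_cover oD.
have -> : phase_space D = \bigcup_k (open_ball_enorm (c k) (r k) `*` sphere).
  rewrite /phase_space {1}DE; apply/seteqP; split => z.
    by move=> [[k _ h] s]; exists k.
  by move=> [k _ [h s]]; split => //; exists k.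
have mo k : measurable (open_ball_enorm (c k) (r k)).
  apply: open_measurable_row.
  rewrite (_ : open_ball_enorm _ _ =
    (fun x : E => dot (x - c k) (x - c k)) @^-1` [set t | t < r k ^+ 2])//.
  apply: open_comp.
    by move=> x _; exact: continuous_dot_sub.
  exact: open_lt.
apply/measurable_fun_bigcup => k.
  by apply: measurableX => //; exact: measurable_sphere.
case: (rD k) => [kD|rk].
  have cK := compact_closed_ball_enorm (c := c k) (r0 k).
  have /measurable_int/measurable_EFinP := wi _ cK kD.
  apply: measurable_funS; first exact: measurable_compact_sphere.
  by move=> z [/ltW].
rewrite (_ : _ `*` _ = set0); first exact: measurable_fun_set0.
apply/seteqP; split => z //= [].
by rewrite rk /open_ball_enorm/= expr0n/= ltNge dot_ge0.
Qed.

End weak_derivative_unique.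

(** * Directional derivatives of test functions *)

Section directional_derivative.
Context {R : realType} {n : nat}.
Local Notation E := 'rV[R]_n.
Implicit Types (D K : set E) (x y v : E) (w phi u : E * E -> R).

Lemma C1x_line phi x y v (t : R) : C1x phi ->
  is_derive t (1 : R) (fun h : R => phi (h *: v + x, y))
    ('D_v (fun x => phi (x, y)) (t *: v + x)).
Proof.
move=> [_ dphi _]; apply/is_derive_line.
have /is_derive_line := derivableP (dphi (t *: v + x, y) v).
rewrite (_ : (fun h : R => phi (h *: v + (t *: v + x), y)) =
  (fun h : R => phi ((h *: (1 : R) + t) *: v + x, y)))//.
by apply/funext => h; rewrite addrA -scalerDl [_%:A]mulr1.
Qed.

(** Mean value theorem on the line through [x] in direction [v], on either side of [0]. *)
Lemma C1x_lipschitz phi y v (M : R) : C1x phi ->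
  (forall x, `|'D_v (fun x => phi (x, y)) x| <= M) ->
  forall x (c : R), `|phi (c *: v + x, y) - phi (x, y)| <= M * `|c|.
Proof.
move=> Cphi dM x c; pose F (h : R) := phi (h *: v + x, y).
have dF t := C1x_line x y v t Cphi.
have cF (a b : R) : {within `[a, b], continuous F}.
  apply: continuous_subspaceT => t.
  by apply/differentiable_continuous/derivable1_diffP; have [] := dF t.
have [c0|/ltW c0] := leP 0 c.
  have [t _] := MVT_segment c0 (fun t _ => dF t) (@cF _ _).
  by rewrite scale0r add0r subr0 => ->; rewrite normrM ler_wpM2r.
have [t _] := MVT_segment c0 (fun t _ => dF t) (@cF _ _).
by rewrite scale0r add0r sub0r distrC => ->; rewrite normrM normrN ler_wpM2r.
Qed.

Lemma C1x_lipschitz_sum phi y (M : 'I_n -> R) : C1x phi ->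
  (forall j x, `|'D_(delta_mx 0 j) (fun x => phi (x, y)) x| <= M j) ->
  forall (s : seq 'I_n) x (c : 'I_n -> R),
  `|phi (\sum_(j <- s) c j *: delta_mx 0 j + x, y) - phi (x, y)| <=
  \sum_(j <- s) M j * `|c j|.
Proof.
move=> Cphi dM s x c; elim: s => [|j s ih].
  by rewrite !big_nil add0r subrr normr0.
rewrite !big_cons -addrA; apply: le_trans (ler_distD
  (phi (\sum_(j <- s) c j *: delta_mx 0 j + x, y)) _ _) _.
by apply: lerD (C1x_lipschitz Cphi (dM j) _ _) ih.
Qed.

(* C1x gives continuity of the derivative for each fixed direction only; telescoping
   the increment along the axes makes the bound uniform in the direction. *)
Lemma C1x_derive_bound phi x y v (M : 'I_n -> R) : C1x phi ->
  (forall j x, `|'D_(delta_mx 0 j) (fun x => phi (x, y)) x| <= M j) ->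
  `|'D_v (fun x => phi (x, y)) x| <= \sum_j M j * `|v 0 j|.
Proof.
move=> Cphi dM; have [_ dphi _] := Cphi.
have H : (fun h : R =>
    h^-1 *: (((fun x => phi (x, y)) \o shift x) (h *: v) - phi (x, y))) @ 0^' -->
    'D_v (fun x => phi (x, y)) x by exact: (dphi (x, y) v).
set B := \sum_j _; change ([set t | t <= B] `|'D_v (fun x => phi (x, y)) x|).
refine (closed_cvg _ (@closed_le _ B) _ _ (cvg_norm H)).
rewrite /B.
near=> h; have h0 : h != 0 by near: h; exact: nbhs_dnbhs_neq.
rewrite /= /GRing.scale/= normrM normfV ler_pdivrMl ?normr_gt0//.
have vE : h *: v = \sum_j (h * v 0 j) *: delta_mx 0 j.
  by rewrite {1}[v]row_sum_delta scaler_sumr; apply: eq_bigr => j _; rewrite scalerA.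
have := C1x_lipschitz_sum Cphi dM (index_enum 'I_n) x (fun j => h * v 0 j).
rewrite -vE => /le_trans; apply.
by rewrite mulr_sumr; apply: ler_sum => j _; rewrite normrM mulrCA.
Unshelve. all: by end_near. Qed.

Definition streaming_derive phi : E * E -> R :=
  fun z => 'D_(z.2) (fun x => phi (x, z.2)) z.1.

Lemma test_function_C1x D phi : test_function D phi -> C1x phi.
Proof. by move=> [? ? ? _]. Qed.

(** The direction [z.2] varies with the point, whereas [C1x] gives continuity for a fixed direction.
    Measurability comes instead from a pointwise limit of the difference quotients with steps
    [m.+1%:R^-1]. *)
Lemma measurable_streaming_derive phi : C1x phi ->
  measurable_fun setT (streaming_derive phi).
Proof.
move=> [cphi dphi _].
apply: (@measurable_fun_cvg _ _ _ _
  (fun (m : nat) (z : E * E) => m.+1%:R * (phi (m.+1%:R^-1 *: z.2 + z.1, z.2) - phi z))).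
  move=> m; apply: measurable_funM => //; apply: measurable_funB; last first.
    exact: continuous_measurable_rows.
  apply: (measurableT_comp (f := phi)); first exact: continuous_measurable_rows.
  apply/measurable_fun_pairP; split; last exact: measurable_snd.
  apply: measurable_fun_rowP => i; under eq_fun do rewrite !mxE.
  apply: measurable_funD.
    by apply: measurable_funM => //; apply: (measurableT_comp (@measurable_coord _ _ n i)).
  by apply: (measurableT_comp (@measurable_coord _ _ n i)).
move=> z _.
have H : (fun h : R =>
    h^-1 *: (((fun x => phi (x, z.2)) \o shift z.1) (h *: z.2) - phi (z.1, z.2))) @ 0^' -->
    streaming_derive phi z by exact: (dphi z z.2).
have K : @harmonic R @ \oo --> 0^'.
  move=> P; rewrite /dnbhs/within/= => hP.
  have : \forall m \near \oo, @harmonic R m != 0 -> P (harmonic m).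
    exact: (@cvg_harmonic R _ hP).
  by apply: filterS => m; apply; rewrite invr_neq0.
have := cvg_comp _ _ K H.
apply: cvg_trans; apply: near_eq_cvg; apply: nearW => m /=.
by rewrite /GRing.scale/= invrK -surjective_pairing.
Qed.

(** Off the closed set [K] the function vanishes in a neighbourhood, hence so do its derivatives.
    Over [K] the axis derivatives are continuous, so bounded on the compact set [K] times the
    sphere, and they control every unit direction by [C1x_derive_bound]. *)
Lemma streaming_derive_bounded D phi : open D -> test_function D phi ->
  exists2 K : set E, compact K /\ K `<=` D &
  (forall z, ~ K z.1 -> streaming_derive phi z = 0) /\
  exists M, forall z, sphere z.2 -> `|streaming_derive phi z| <= M.
Proof.
move=> oD tphi; have Cphi := test_function_C1x tphi.
have [cphi dphi dcphi [K [cK KD phi0]]] := tphi.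
have out z v : ~ K z.1 -> 'D_v (fun x => phi (x, z.2)) z.1 = 0.
  move=> nK; rewrite (@near_eq_derive _ _ _ _ (cst 0)) ?derive_cst//.
  have oK : open (~` K) by apply: closed_openC; exact: compact_closed.
  apply: filterS (open_nbhs_nbhs (conj oK nK)) => x nx.
  by rewrite phi0.
exists K => //; split; first by move=> z nK; exact: out.
have bM j : exists M, forall z, sphere z.2 ->
    `|'D_(delta_mx 0 j) (fun x => phi (x, z.2)) z.1| <= M.
  have [M [_ HM]] := bounded_on_compact_sphere (dcphi (delta_mx 0 j)) cK.
  exists (`|M| + 1) => z Sz; have [Kz|nK] := pselect (K z.1).
    by apply: HM => //; rewrite (le_lt_trans (ler_norm _))// ltrDl.
  by rewrite out// normr0 addr_ge0.
have [M HM] := choice bM.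
exists (\sum_j M j) => z Sz.
apply: le_trans (C1x_derive_bound z.1 z.2 Cphi (fun j x => HM j (x, z.2) Sz)) _.
apply: ler_sum => j _; rewrite ler_piMr//.
  by apply: le_trans (HM j z Sz).
by rewrite -(_ : enorm z.2 = 1)//; exact: coord_le_enorm.
Qed.

End directional_derivative.

(** * Weighted square-integrable functions *)

Section weighted_L2.
Context d (T : measurableType d) (R : realType) (mu : {measure set T -> \bar R}).
Variables (A : set T) (mA : measurable A).
Implicit Types (f g h k : T -> R).

Lemma ae_eq_integrable f g : measurable_fun A f -> measurable_fun A g ->
  (\forall x \ae mu, A x -> f x = g x) ->
  mu.-integrable A (EFin \o f) -> mu.-integrable A (EFin \o g).
Proof.
move=> mf mg fg /integrableP[_ fi]; apply/integrableP; split.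
  exact/measurable_EFinP.
rewrite (ae_eq_integral (fun x => `|(f x)%:E|%E))//.
- by apply: measurableT_comp => //; exact/measurable_EFinP.
- by apply: measurableT_comp => //; exact/measurable_EFinP.
- by apply: filterS fg => x /[apply] ->.
Qed.

Lemma ae_eq_Rintegral f g : measurable_fun A f -> measurable_fun A g ->
  (\forall x \ae mu, A x -> f x = g x) ->
  \int[mu]_(x in A) f x = \int[mu]_(x in A) g x.
Proof.
move=> mf mg fg; congr fine; apply: ae_eq_integral => //.
- exact/measurable_EFinP.
- exact/measurable_EFinP.
- by apply: filterS fg => x /[apply] ->.
Qed.

Variables (wt : T -> R) (mwt : measurable_fun A wt) (wt0 : forall x, 0 <= wt x).

(** Common form of [L2_phase], with weight [1], and of [L2_inflow], with weight [|n . omega|], so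
    that the bilinear algebra is done once. *)
Definition wL2 h := measurable_fun A h /\
  mu.-integrable A (fun x => (h x ^+ 2 * wt x)%:E).

Definition wdot h k := \int[mu]_(x in A) (h x * k x * wt x).

(** Domination by [|h k| <= h ^+ 2 + k ^+ 2]. *)
Lemma wL2_mul h k : wL2 h -> wL2 k ->
  mu.-integrable A (EFin \o (fun x => h x * k x * wt x)).
Proof.
move=> [mh hi] [mk ki].
apply: (le_integrable mA) (integrableD mA hi ki) => //.
  by apply/measurable_EFinP; do !apply: measurable_funM.
move=> x Ax; rewrite /= lee_fin normrM (ger0_norm (wt0 x)) -mulrDl.
rewrite [leRHS]ger0_norm ?mulr_ge0// ?addr_ge0 ?sqr_ge0//.
apply: ler_wpM2r => //.
by rewrite ler_norml; apply/andP; split; nra.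
Qed.

Lemma wL2_ae h k : wL2 h -> measurable_fun A k ->
  (\forall x \ae mu, A x -> h x = k x) -> wL2 k.
Proof.
move=> [mh hi] mk hk; split => //.
apply: ae_eq_integrable hi.
- by apply: measurable_funM => //; apply: measurable_funX.
- by apply: measurable_funM => //; apply: measurable_funX.
- by apply: filterS hk => x /[apply] ->.
Qed.

Lemma wL2_lin h k (a b : R) : wL2 h -> wL2 k ->
  wL2 (fun x => a * h x + b * k x).
Proof.
move=> hh kk; have hki := wL2_mul hh kk; have [mh hi] := hh; have [mk ki] := kk.
split; first by apply: measurable_funD; apply: measurable_funM.
have := integrableD mA (integrableZl mA (a ^+ 2) hi)
  (integrableD mA (integrableZl mA (2 * a * b) hki) (integrableZl mA (b ^+ 2) ki)).
apply: eq_integrable => // x _ /=; rewrite -!EFinM -!EFinD; congr EFin.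
by ring.
Qed.

Lemma wdot_ae h h' k k' : wL2 h -> wL2 k -> wL2 h' -> wL2 k' ->
  (\forall x \ae mu, A x -> h x = h' x) ->
  (\forall x \ae mu, A x -> k x = k' x) -> wdot h k = wdot h' k'.
Proof.
move=> [mh _] [mk _] [mh' _] [mk' _] hh kk; apply: ae_eq_Rintegral.
- by do !apply: measurable_funM.
- by do !apply: measurable_funM.
- by apply: filterS2 hh kk => x h1 h2 Ax; rewrite h1// h2.
Qed.

Lemma wdotC h k : wdot h k = wdot k h.
Proof. by apply: eq_Rintegral => x _; rewrite (mulrC (h x)). Qed.

Lemma wdot_ge0 h : 0 <= wdot h h.
Proof. by apply: Rintegral_ge0 => x _; rewrite mulr_ge0// -expr2 sqr_ge0. Qed.

Lemma wdot_linl h1 h2 k (a b : R) : wL2 h1 -> wL2 h2 -> wL2 k ->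
  wdot (fun x => a * h1 x + b * h2 x) k = a * wdot h1 k + b * wdot h2 k.
Proof.
move=> w1 w2 wk; have i1 := wL2_mul w1 wk; have i2 := wL2_mul w2 wk.
rewrite /wdot -(RintegralZl _ mA i1) -(RintegralZl _ mA i2).
rewrite -RintegralD//; last 2 first.
- by apply: eq_integrable (integrableZl mA a i1).
- by apply: eq_integrable (integrableZl mA b i2).
by apply: eq_Rintegral => x _; ring.
Qed.

Lemma wdot_linr h1 h2 k (a b : R) : wL2 h1 -> wL2 h2 -> wL2 k ->
  wdot k (fun x => a * h1 x + b * h2 x) = a * wdot k h1 + b * wdot k h2.
Proof. by move=> *; rewrite wdotC wdot_linl// !(wdotC k). Qed.

Lemma wdot_aeZ h h' k (a : R) : wL2 h -> wL2 h' -> wL2 k ->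
  (\forall x \ae mu, A x -> h' x = a * h x) -> wdot k h' = a * wdot k h.
Proof.
move=> wh wh' wk e.
(* The zero term brings the scalar multiple to the two-term shape of [wdot_linr]. *)
rewrite (@wdot_ae k k h' (fun x => a * h x + 0 * h x))//.
- by rewrite wdot_linr//; ring.
- exact: wL2_lin.
- exact: aeW.
- by apply: filterS e => x /[apply] ->; ring.
Qed.

Lemma wdot_aeZ2 h h' (a : R) : wL2 h -> wL2 h' ->
  (\forall x \ae mu, A x -> h' x = a * h x) -> wdot h' h' = a ^+ 2 * wdot h h.
Proof.
move=> wh wh' e.
by rewrite (wdot_aeZ wh wh' wh' e) wdotC (wdot_aeZ wh wh' wh e) expr2 mulrA.
Qed.

End weighted_L2.

(** * Linearity of the streaming operator *)

Lemma Rintegral_lin d (T : measurableType d) (R : realType)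
    (mu : {measure set T -> \bar R}) (A : set T) (f g : T -> R) (a b : R) :
  measurable A -> mu.-integrable A (EFin \o f) -> mu.-integrable A (EFin \o g) ->
  \int[mu]_(x in A) (a * f x + b * g x) =
  a * \int[mu]_(x in A) f x + b * \int[mu]_(x in A) g x.
Proof.
move=> mA fi gi; rewrite RintegralD ?RintegralZl//.
- by apply: eq_integrable (integrableZl mA a fi).
- by apply: eq_integrable (integrableZl mA b gi).
Qed.

Section streaming.
Context {R : realType} {n : nat}.
Local Notation E := 'rV[R]_n.
Local Notation mu := (@phase_measure R n).
Implicit Types (D K : set E) (w phi u : E * E -> R).

Lemma L2_phaseE D u :
  L2_phase D u <-> wL2 mu (phase_space D) (cst 1) u.
Proof.
rewrite /L2_phase /wL2; suff -> : (fun z => (u z ^+ 2 * cst 1 z)%:E) =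
  (fun z => (u z ^+ 2)%:E) by [].
by apply/funext => z; rewrite mulr1.
Qed.

Lemma sqnorm_phaseE D u : sqnorm_phase D u = wdot mu (phase_space D) (cst 1) u u.
Proof. by apply: eq_Rintegral => z _; rewrite mulr1 expr2. Qed.

Lemma phase_measure_compact_lty K : compact K -> (mu (K `*` sphere) < +oo)%E.
Proof.
move=> cK; rewrite /phase_measure/= product_measure1E; last 2 first.
- exact: measurable_compact_row.
- exact: measurable_sphere.
rewrite lte_mul_pinfty//.
- rewrite ge0_fin_numE//.
  have [M [_ HM]] := compact_bounded cK.
  have M1 : 0 <= `|M| + 1 by rewrite addr_ge0.
  apply: (@le_lt_trans _ _ (lebesgue_row n [set x : E | forall i, `|x 0 i| <= `|M| + 1])).
    apply: le_measure; rewrite ?inE; first exact: measurable_compact_row.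
      exact: measurable_row_box.
    move=> x Kx i; have /(_ _ x Kx) := HM (`|M| + 1) _.
    rewrite (le_lt_trans (ler_norm _)) ?ltrDl// => /(_ isT).
    apply: le_trans.
    by rewrite [leRHS]/Num.norm/= mx_normrE; apply/bigmax_geP; right; exists (0, i).
  by rewrite lebesgue_row_box// ltry.
- by rewrite -ge0_fin_numE// fin_num_measure//; exact: measurable_sphere.
Qed.

(** Makes the product of an L^2 function with the derivative of a test function integrable, as is
    required to split the weak formulation of a linear combination. *)
Lemma wL2_streaming_derive D phi : open D -> test_function D phi ->
  wL2 mu (phase_space D) (cst 1) (streaming_derive phi).
Proof.
move=> oD tphi; have mg := measurable_streaming_derive (test_function_C1x tphi).
have [K [cK KD] [out [M HM]]] := streaming_derive_bounded oD tphi.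
have mK := measurable_compact_sphere cK.
split; first exact: measurable_funTS.
apply: (integrable_support mK).
- by apply: measurable_phase_space; exact: open_measurable_row.
- by move=> z [/KD].
- move=> z [_ Sz] nK; rewrite out ?expr0n ?mul0r// => Kz; exact: nK.
apply: (@measurable_bounded_integrable _ _ _ mu
  (fun z => streaming_derive phi z ^+ 2 * cst 1 z)) => //.
- exact: phase_measure_compact_lty.
- by apply: measurable_funM => //; apply: measurable_funX; exact: measurable_funTS.
exists (M ^+ 2); split; first exact: num_real.
move=> N MN z [_ Sz]; rewrite /= mulr1 ger0_norm ?sqr_ge0//.
apply: le_trans (ltW MN); rewrite -[leLHS]real_normK ?num_real//.
by rewrite ler_sqr ?nnegrE ?HM//; apply: le_trans (HM z Sz).
Qed.

Lemma weak_streaming_lin D u1 u2 w1 w2 (a b : R) : open D ->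
  L2_phase D u1 -> L2_phase D u2 ->
  weak_streaming D u1 w1 -> weak_streaming D u2 w2 ->
  weak_streaming D (fun z => a * u1 z + b * u2 z) (fun z => a * w1 z + b * w2 z).
Proof.
move=> oD /L2_phaseE l1 /L2_phaseE l2 [i1 h1] [i2 h2]; split.
  move=> K cK KD; have mK := measurable_compact_sphere cK.
  have := integrableD mK (integrableZl mK a (i1 K cK KD)) (integrableZl mK b (i2 K cK KD)).
  by apply: eq_integrable.
move=> phi tphi.
have mD : measurable (phase_space D).
  by apply: measurable_phase_space; exact: open_measurable_row.
have lphi := wL2_streaming_derive oD tphi.
have uint u : wL2 mu (phase_space D) (cst 1) u ->
    mu.-integrable (phase_space D) (EFin \o (fun z => u z * streaming_derive phi z)).
  move=> lu; have := @wL2_mul _ _ _ mu _ mD _ (measurable_cst _) (fun _ => ler01) _ _ lu lphi.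
  by apply: eq_integrable => // z _; rewrite /= mulr1.
transitivity (\int[mu]_(z in phase_space D) (a * (u1 z * streaming_derive phi z) +
     b * (u2 z * streaming_derive phi z))).
  by apply: eq_Rintegral => z _; rewrite /streaming_derive; ring.
rewrite Rintegral_lin//; [|exact: uint|exact: uint].
rewrite (h1 _ tphi) (h2 _ tphi).
transitivity (- \int[mu]_(z in phase_space D) (a * (w1 z * phi z) + b * (w2 z * phi z))).
  rewrite Rintegral_lin//; last 2 first.
    exact: integrable_mul_test i1 tphi.
    exact: integrable_mul_test i2 tphi.
  by ring.
by congr (- _); apply: eq_Rintegral => z _; ring.
Qed.

(** The difference of two weak derivatives is locally integrable and orthogonal to every test
    function, so [weak_zero] applies. *)
Lemma weak_streaming_unique D u w1 w2 : open D ->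
  weak_streaming D u w1 -> weak_streaming D u w2 ->
  \forall z \ae mu, phase_space D z -> w1 z = w2 z.
Proof.
move=> oD [i1 h1] [i2 h2].
have mD : measurable (phase_space D).
  by apply: measurable_phase_space; exact: open_measurable_row.
have : \forall z \ae mu, phase_space D z -> w1 z - w2 z = 0.
  apply: weak_zero => //.
    move=> K cK KD; have mK := measurable_compact_sphere cK.
    exact: integrableB (i1 K cK KD) (i2 K cK KD).
  move=> phi tphi; have := h1 _ tphi; rewrite (h2 _ tphi) => /oppr_inj e.
  transitivity (\int[mu]_(z in phase_space D) (w1 z * phi z - w2 z * phi z)).
    by apply: eq_Rintegral => z _; rewrite mulrBl.
  rewrite RintegralB//; last 2 first.
    exact: integrable_mul_test i1 tphi.
    exact: integrable_mul_test i2 tphi.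
  by rewrite -e subrr.
by apply: filterS => z H Dz; apply/eqP; rewrite -subr_eq0 H.
Qed.

Lemma streamingP D u : (exists w, weak_streaming D u w) ->
  weak_streaming D u (streaming D u).
Proof. by move=> ex; exact: (xgetPex (cst 0) ex). Qed.

Lemma streaming_lin D u1 u2 (a b : R) : open D ->
  L2_phase D u1 -> L2_phase D u2 ->
  (exists w, weak_streaming D u1 w) -> (exists w, weak_streaming D u2 w) ->
  weak_streaming D (fun z => a * u1 z + b * u2 z)
    (streaming D (fun z => a * u1 z + b * u2 z)) /\
  \forall z \ae mu, phase_space D z ->
    streaming D (fun z => a * u1 z + b * u2 z) z =
    a * streaming D u1 z + b * streaming D u2 z.
Proof.
move=> oD l1 l2 /streamingP s1 /streamingP s2.
have s := weak_streaming_lin a b oD l1 l2 s1 s2.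
have s' := streamingP (ex_intro _ _ s).
by split => //; exact: weak_streaming_unique oD s' s.
Qed.

End streaming.

(** * Linearity of the scattering operator *)

(** Tonelli's theorem for the positive and the negative part; the real-valued integral is [fine] of
    their difference. *)
Lemma measurable_fun_Rintegral_snd d1 d2 (T1 : measurableType d1)
    (T2 : measurableType d2) (R : realType)
    (m2 : {sigma_finite_measure set T2 -> \bar R}) (f : T1 * T2 -> R) :
  measurable_fun setT f ->
  measurable_fun setT (fun x => \int[m2]_y f (x, y)).
Proof.
move=> mf; have mEf : measurable_fun setT (EFin \o f) by exact/measurable_EFinP.
apply: (measurableT_comp (f := fine)) => //.
rewrite (_ : (fun x => _) = (fun x => fubini_F m2 (EFin \o f)^\+ x -
    fubini_F m2 (EFin \o f)^\- x)%E).
  apply: emeasurable_funB; apply: measurable_fun_fubini_tonelli_F => //.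
    exact: measurable_funepos.
  exact: measurable_funeneg.
apply/funext => x; rewrite [LHS]integralE /fubini_F.
by congr (_ - _)%E; apply: eq_integral => y _; rewrite ?(funeposE, funenegE).
Qed.

Section scattering.
Context {R : realType} {n : nat}.
Local Notation E := 'rV[R]_n.
Local Notation mu := (@phase_measure R n).
Local Notation sm := (@sphere_measure R n).
Implicit Types (D K : set E) (u : E * E -> R) (p : R -> R).

(** Cauchy-Schwarz for unit vectors, from the nonnegativity of the squared norms of [x + y] and
    [x - y]. *)
Lemma dot_sphere_itv (x y : E) : sphere x -> sphere y -> dot x y \in `[(-1 : R), 1].
Proof.
move=> Sx Sy.
have dx : dot x x = 1 by rewrite -sqr_enorm Sx expr1n.
have dy : dot y y = 1 by rewrite -sqr_enorm Sy expr1n.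
have H (s : R) : s ^+ 2 = 1 -> 0 <= 1 + 1 + 2 * s * dot x y.
  move=> s2; have := dot_ge0 (x + s *: y).
  have -> : dot (x + s *: y) (x + s *: y) =
      dot x x + s ^+ 2 * dot y y + 2 * s * dot x y.
    rewrite /dot !mulr_sumr -!big_split/=.
    by apply: eq_bigr => i _; rewrite !mxE; ring.
  by rewrite dx dy s2 mulr1.
rewrite in_itv/=; apply/andP; split.
  by have := H 1 (expr1n _ _); lra.
have := H (-1); rewrite sqrrN expr1n => /(_ erefl); lra.
Qed.

Lemma measurable_dot : measurable_fun setT (fun z : E * E => dot z.1 z.2).
Proof.
apply: measurable_sum => i; apply: measurable_funM.
  exact: (measurableT_comp (@measurable_coord _ _ n i)).
exact: (measurableT_comp (@measurable_coord _ _ n i)).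
Qed.

Definition scattering_integral p u : E * E -> R :=
  fun z => \int[sm]_(w in sphere) (p (dot z.2 w) * u (z.1, w)).

Lemma measurable_phase_function p :
  phase_function p -> measurable_fun (`[(-1 : R), 1] : set R) p.
Proof.
by move=> [[cp _] _ _]; apply: subspace_continuous_measurable_fun.
Qed.

Lemma measurable_scattering_integral D u p : measurable D -> phase_function p ->
  measurable_fun (phase_space D) u ->
  measurable_fun (phase_space D) (scattering_integral p u).
Proof.
move=> mD hp mu_; have mP := measurable_phase_space mD.
(* Extension by zero makes both factors measurable everywhere. The integral over the sphere is
   unchanged: there the argument of [p] lies in [[-1, 1]], and off the sphere [ur] vanishes. *)
pose pr : R -> R := p \_ (`[(-1 : R), 1] : set R); pose ur := u \_ (phase_space D).
have mpr : measurable_fun setT pr.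
  have mI : measurable (`[(-1 : R), 1] : set R) by [].
  exact: ((measurable_restrictT p mI).1 (measurable_phase_function hp)).
have mur : measurable_fun setT ur := (measurable_restrictT u mP).1 mu_.
pose F (zw : (E * E) * E) := pr (dot zw.1.2 zw.2) * ur (zw.1.1, zw.2).
have mF : measurable_fun setT F.
  apply: measurable_funM.
    apply: (measurableT_comp mpr).
    apply: (measurableT_comp measurable_dot (g := fun zw : (E * E) * E => (zw.1.2, zw.2))).
    apply/measurable_fun_pairP; split; last exact: measurable_snd.
    exact: (measurableT_comp (f := snd) measurable_snd measurable_fst).
  apply: (measurableT_comp mur (g := fun zw : (E * E) * E => (zw.1.1, zw.2))).
  apply/measurable_fun_pairP; split; last exact: measurable_snd.
  exact: (measurableT_comp (f := fst) measurable_fst measurable_fst).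
have := measurable_funTS (measurable_fun_Rintegral_snd sm mF) (D := phase_space D).
apply: eq_measurable_fun => z; rewrite inE => -[Dz Sz].
rewrite /scattering_integral [RHS]Rintegral_mkcond; apply: eq_Rintegral => w _.
rewrite patchE; case: ifPn => Sw.
  rewrite inE in Sw; rewrite /F/= /pr /ur !patchE ifT; last first.
    by rewrite inE/=; exact: dot_sphere_itv.
  by rewrite ifT// inE.
rewrite /F/= /ur patchE ifF ?mulr0//.
by apply/negbTE; move: Sw; rewrite !notin_setE => Sw [].
Qed.

Lemma ae_fst_phase (P : E -> Prop) :
  (\forall x \ae @lebesgue_row R n, P x) -> \forall z \ae mu, P z.1.
Proof.
move=> [N [mN N0 sub]]; exists (N `*` setT); split.
- exact: measurableX.
- by rewrite /phase_measure/= product_measure1E// [X in (X * _)%E]N0 mul0e.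
- by move=> z /= nP; split => //; apply: sub.
Qed.

(** By Fubini, almost every slice of [u ^+ 2] is integrable; since the sphere has finite measure,
    the slice of [u] can be paired with the constant [1]. *)
Lemma ae_integrable_sphere D u : measurable D -> L2_phase D u ->
  \forall x \ae @lebesgue_row R n, D x ->
    sm.-integrable sphere (EFin \o (fun w => u (x, w))).
Proof.
move=> mD [mu_ ui]; have mP := measurable_phase_space mD.
have mur : measurable_fun setT (u \_ (phase_space D)) :=
  (measurable_restrictT u mP).1 mu_.
have /(integrable_mkcond _ mP) := ui.
move=> /ae_integrable1; apply: filterS => x ix Dx.
have mS := @measurable_sphere R n.
have mux : measurable_fun sphere (fun w => u (x, w)).
  apply: (@eq_measurable_fun _ _ _ _ _ (fun w => (u \_ (phase_space D)) (x, w))).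
    by move=> w Sw; rewrite patchE ifT// inE; rewrite inE in Sw; split.
  apply: measurable_funTS.
  exact: (measurableT_comp mur (measurable_pair1 x)).
have l2 : wL2 sm sphere (cst 1) (fun w => u (x, w)).
  split => //; apply/(integrable_mkcond _ mS); apply: eq_integrable ix => // w _.
  rewrite !patchE; congr (if _ then _ else _); last by rewrite mulr1.
  by apply/idP/idP; rewrite !inE => // -[].
have l1 : wL2 sm sphere (cst 1) (cst 1).
  split => //; apply: (@measurable_bounded_integrable _ _ _ sm (fun=> 1 ^+ 2 * 1)) => //.
    by rewrite -ge0_fin_numE// fin_num_measure.
  by exists 1; split => // M M1 w _ /=; rewrite expr1n mulr1 normr1 ltW.
have := @wL2_mul _ _ _ sm _ mS _ (measurable_cst _) (fun _ => ler01) _ _ l2 l1.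
by apply: eq_integrable => // w _; rewrite /= !mulr1.
Qed.

(** Linearity holds at those [x] where both slices are integrable, since [p], continuous on a
    compact interval, is bounded and preserves integrability. *)
Lemma scattering_integral_lin D u1 u2 p (a b : R) : measurable D ->
  phase_function p -> L2_phase D u1 -> L2_phase D u2 ->
  \forall z \ae mu, phase_space D z ->
    scattering_integral p (fun z => a * u1 z + b * u2 z) z =
    a * scattering_integral p u1 z + b * scattering_integral p u2 z.
Proof.
move=> mD hp l1 l2.
have i1 := ae_fst_phase (ae_integrable_sphere mD l1).
have i2 := ae_fst_phase (ae_integrable_sphere mD l2).
have mS := @measurable_sphere R n.
have mp := measurable_phase_function hp.
have [[cp _] _ _] := hp.
have bp : [bounded p y | y in `[(-1 : R), 1]].
  have := compact_bounded (continuous_compact cp (@segment_compact R (-1) 1)).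
  by move=> [M [Mr H]]; exists M; split => // x /H {}H z zK; apply: H; exists z.
apply: filterS2 i1 i2 => z h1 h2 [Dz Sz].
have pint u : sm.-integrable sphere (EFin \o (fun w => u (z.1, w))) ->
    sm.-integrable sphere (EFin \o (fun w => p (dot z.2 w) * u (z.1, w))).
  move=> iu; have := @integrableMr _ _ _ sm _ mS (fun w => p (dot z.2 w)) _ _ _ iu.
  apply.
    apply: (measurable_comp (F := `[(-1 : R), 1])) => //.
      by move=> _ [w Sw <-]; exact: dot_sphere_itv.
    apply: measurable_funTS.
    exact: (measurableT_comp measurable_dot (measurable_pair1 z.2)).
  have [M [Mr H]] := bp; exists M; split => // x /H {}H w Sw; apply: H.
  exact: dot_sphere_itv.
rewrite /scattering_integral.
rewrite -(Rintegral_lin a b mS (pint _ (h1 Dz)) (pint _ (h2 Dz))).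
by apply: eq_Rintegral => w _; ring.
Qed.

Lemma transport_scattering_lin D u1 u2 p (sA sT a b : R) : open D ->
  phase_function p -> L2_phase D u1 -> L2_phase D u2 ->
  (exists w, weak_streaming D u1 w) -> (exists w, weak_streaming D u2 w) ->
  let T := transport_scattering D sA sT p in
  measurable_fun (phase_space D) (T (fun z => a * u1 z + b * u2 z)) /\
  \forall z \ae mu, phase_space D z ->
    T (fun z => a * u1 z + b * u2 z) z = a * T u1 z + b * T u2 z.
Proof.
move=> oD hp l1 l2 s1 s2 T.
have mD := open_measurable_row oD.
have mP := measurable_phase_space mD.
have [[si _] sl] := streaming_lin a b oD l1 l2 s1 s2.
have [m1 _] := l1; have [m2 _] := l2.
have mu_ : measurable_fun (phase_space D) (fun z => a * u1 z + b * u2 z).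
  by apply: measurable_funD; apply: measurable_funM.
split.
  apply: measurable_funD.
    apply: measurable_funD; last exact: measurable_funM.
    exact: locally_integrable_measurable si.
  apply: measurable_funM => //; apply: measurable_funB => //.
  apply: measurable_funM => //.
  exact: (measurable_scattering_integral mD hp mu_).
have il := scattering_integral_lin a b mD hp l1 l2.
apply: filterS2 sl il => z h1 h2 Dz.
rewrite /T /transport_scattering /transport /scattering /= h1//.
have := h2 Dz; rewrite /scattering_integral => ->.
by ring.
Qed.

End scattering.

(** * Traces and the Uzawa iteration *)

Section trace.
Context {R : realType} {d : nat}.
Local Notation E := 'rV[R]_d.
Local Notation mub := (@boundary_measure R d).
Implicit Types (D : set E) (n : E -> E) (u h : E * E -> R).

Lemma measurable_inflow_weight D n : measurable_fun (boundary D) n ->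
  measurable_fun (inflow D n) (fun z => `|dot (n z.1) z.2|).
Proof.
move=> mn; apply: measurableT_comp => //.
apply: (measurable_funS _ _ (measurable_normal_dot mn)).
  by apply: measurableX => //; exact: measurable_boundary.
by move=> z [].
Qed.

Lemma is_trace_lin D n u1 u2 h1 h2 (a b : R) :
  is_trace D n u1 h1 -> is_trace D n u2 h2 ->
  is_trace D n (fun z => a * u1 z + b * u2 z) (fun z => a * h1 z + b * h2 z).
Proof.
move=> [m1 H1] [m2 H2]; split.
  by apply: measurable_funD; apply: measurable_funM.
apply: filterS2 H1 H2 => z H1 H2 iz e e0.
(* The summand [1] keeps [c] positive when [a = b = 0] and makes the final inequality strict. *)
pose c := `|a| + `|b| + 1.
have c0 : 0 < c by rewrite ltr_wpDl// addr_ge0.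
have [t1 t10 A1] := H1 iz _ (divr_gt0 e0 c0).
have [t2 t20 A2] := H2 iz _ (divr_gt0 e0 c0).
exists (Num.min t1 t2); first by rewrite lt_min t10.
have F := @ae_filter_ringOfSetsType _ (measurableTypeR R) R (@lebesgue_measure R).
apply: (@filterS2 _ _ F) A1 A2 => t A1 A2; rewrite lt_min => /and3P[t0 tt1 tt2].
have {}A1 := A1 ltac:(by rewrite t0). have {}A2 := A2 ltac:(by rewrite t0).
rewrite (_ : _ - _ = a * (u1 (z.1 + t *: z.2, z.2) - h1 z) +
  b * (u2 (z.1 + t *: z.2, z.2) - h2 z)); last by ring.
apply: le_lt_trans (ler_normD _ _) _; rewrite !normrM.
apply: (@le_lt_trans _ _ (`|a| * (e / c) + `|b| * (e / c))).
  by apply: lerD; apply: ler_wpM2l => //; exact: ltW.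
rewrite -mulrDl mulrCA -[ltRHS]mulr1 ltr_pM2l// ltr_pdivrMr// mul1r.
by rewrite /c ltrDl.
Qed.

(** Two distinct essential limits cannot both be approached within half their distance, so an
    interval of positive length to the right of [0] would be a null set. *)
Lemma is_trace_unique D n u h1 h2 : is_trace D n u h1 -> is_trace D n u h2 ->
  \forall z \ae mub, inflow D n z -> h1 z = h2 z.
Proof.
move=> [_ H1] [_ H2]; apply: filterS2 H1 H2 => z H1 H2 iz.
apply/eqP; rewrite -subr_eq0 -normr_eq0; apply/negP => /negP.
rewrite -normr_gt0 normr_id => h0.
have e0 : 0 < `|h1 z - h2 z| / 2 by rewrite divr_gt0.
have [t1 t10 A1] := H1 iz _ e0.
have [t2 t20 A2] := H2 iz _ e0.
have F := @ae_filter_ringOfSetsType _ (measurableTypeR R) R (@lebesgue_measure R).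
have [N [mN N0 sub]] := @filterI _ _ F _ _ A1 A2.
have : (@lebesgue_measure R `]0%R, Num.min t1 t2[ <= @lebesgue_measure R N)%E.
  apply: le_measure; rewrite ?inE//.
  move=> t /=; rewrite in_itv/= lt_min => /and3P[t0 tt1 tt2]; apply: sub => /= -[].
  rewrite t0 tt1 tt2 => /(_ isT) B1 /(_ isT) B2.
  have := ler_distD (u (z.1 + t *: z.2, z.2)) (h1 z) (h2 z).
  by rewrite (distrC (h1 z) (u _)); lra.
rewrite N0 lebesgue_measure_itv/= lte_fin lt_min t10 t20/= sube0 lee_fin.
by rewrite leNgt lt_min t10 t20.
Qed.

Lemma traceP D n u : (exists h, is_trace D n u h) -> is_trace D n u (trace D n u).
Proof. by move=> ex; exact: (xgetPex (cst 0) ex). Qed.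

End trace.

(** * Real-number lemmas for the descent argument *)

(** The sequence [L] decreases and is bounded below, so it converges and its increments, which
    dominate [c * x k], tend to zero. *)
Lemma descent_cvg0 (R : realType) (L x : nat -> R) (c : R) : 0 < c ->
  (forall k, 0 <= L k) -> (forall k, 0 <= x k) ->
  (forall k, L k.+1 + c * x k <= L k) -> x @ \oo --> (0 : R).
Proof.
move=> c0 L0 x0 dec.
have cL : cvgn L.
  apply: nonincreasing_is_cvgn; last by exists 0 => _ [k _ <-].
  apply/nonincreasing_seqP => k; apply: le_trans (dec k).
  by rewrite lerDl mulr_ge0// ltW.
have dL : (fun k => c^-1 * (L k - L k.+1)) @ \oo --> (0 : R).
  rewrite -(mulr0 c^-1) -(subrr (limn L)); apply: cvgM; first exact: cvg_cst.
  by apply: cvgB => //; rewrite cvg_shiftS.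
apply: (squeeze_cvgr _ (cvg_cst 0) dL); apply: nearW => k; rewrite x0/=.
by rewrite ler_pdivlMl// lerBrDl.
Qed.

(** Optimality at [s = 1] without differentiation. For [m > 0], comparison with the true minimiser
    [s = c / m] gives [(m - c) ^+ 2 <= 0]; for [m = 0], the values [s = 0] and [s = 2] force
    [c = 0]. *)
Lemma quadratic_argmin1 (R : realType) (m c : R) : 0 <= m ->
  (forall s, 2^-1 * m - c <= 2^-1 * s ^+ 2 * m - s * c) -> m = c.
Proof.
move=> m0 H; have [m1|m1] := eqVneq m 0.
  by have := H 0; have := H 2; rewrite m1; lra.
have mp : 0 < m by rewrite lt_neqAle eq_sym m1.
have h1 := sqr_ge0 (m - c); have := H (c / m).
rewrite -(ler_pM2r mp).
have -> : (2^-1 * (c / m) ^+ 2 * m - c / m * c) * m = - (2^-1 * c ^+ 2) by field.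
move=> h2; have {}h2 : (m - c) ^+ 2 <= 0 by nra.
have /eqP : (m - c) ^+ 2 = 0 by apply/eqP; rewrite eq_le h1 h2.
by rewrite sqrf_eq0 subr_eq0 => /eqP.
Qed.

(** * Linearity on the solution space and energy identities of the Uzawa step *)

Section uzawa.
Context {R : realType} {d : nat}.
Local Notation E := 'rV[R]_d.
Local Notation mu := (@phase_measure R d).
Local Notation mub := (@boundary_measure R d).
Variables (D : set E) (n : E -> E) (oD : open D)
  (mn : measurable_fun (boundary D) n)
  (sA sT : R) (p : R -> R) (hp : phase_function p).
Implicit Types (u h : E * E -> R).
Local Notation T := (transport_scattering D sA sT p).
Local Notation tr := (trace D n).
Local Notation V := (V_space D n sA sT p).
Local Notation wt := (fun z : E * E => `|dot (n z.1) z.2|).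

Let mP : measurable (phase_space D).
Proof. by apply: measurable_phase_space; exact: open_measurable_row. Qed.

Let mI : measurable (inflow D n). Proof. exact: measurable_inflow. Qed.

Let mwt : measurable_fun (inflow D n) wt.
Proof. exact: measurable_inflow_weight. Qed.

Let wt0 (z : E * E) : 0 <= wt z. Proof. exact: normr_ge0. Qed.

Let m1 : measurable_fun (phase_space D) (cst (1 : R)).
Proof. exact: measurable_cst. Qed.

Let cst1_ge0 (z : E * E) : 0 <= cst (1 : R) z. Proof. exact: ler01. Qed.

(** Membership in [V] provides some square-integrable trace; by uniqueness the chosen one agrees
    with it almost everywhere. *)
Lemma V_space_trace u : V u -> is_trace D n u (tr u) /\ L2_inflow D n (tr u).
Proof.
move=> [_ _ _ [h th lh]]; have tu := traceP (ex_intro _ _ th); split => //.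
apply: wL2_ae lh _ _ => //; first by have [] := tu.
exact: is_trace_unique th tu.
Qed.

Lemma V_space_lin u1 u2 (a b : R) : V u1 -> V u2 ->
  [/\ V (fun z => a * u1 z + b * u2 z),
    \forall z \ae mu, phase_space D z ->
      T (fun z => a * u1 z + b * u2 z) z = a * T u1 z + b * T u2 z &
    \forall z \ae mub, inflow D n z ->
      tr (fun z => a * u1 z + b * u2 z) z = a * tr u1 z + b * tr u2 z].
Proof.
move=> V1 V2; have [t1 lt1] := V_space_trace V1; have [t2 lt2] := V_space_trace V2.
have [l1 s1 T1 _] := V1; have [l2 s2 T2 _] := V2.
have t := is_trace_lin a b t1 t2.
have [mT eT] := transport_scattering_lin sA sT a b oD hp l1 l2 s1 s2.
split => //; last exact: is_trace_unique (traceP (ex_intro _ _ t)) t.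
split.
- by apply/L2_phaseE; apply: wL2_lin => //; exact/L2_phaseE.
- by have [] := streaming_lin a b oD l1 l2 s1 s2; eexists; eassumption.
- apply/L2_phaseE.
  apply: (wL2_ae mP m1 (h := fun z => a * T u1 z + b * T u2 z)) => //.
    by apply: wL2_lin => //; exact/L2_phaseE.
  by apply: filterS eT => z /[apply].
- by eexists; [exact: t|exact: wL2_lin].
Qed.

Variables (g ustar : E * E -> R) (hg : L2_inflow D n g)
  (hstar : bvp_solution D n sA sT p g ustar).

Lemma V_space_gap u : V u -> L2_inflow D n (tr u \- g).
Proof.
move=> Vu; have [_ lu] := V_space_trace Vu.
have := wL2_lin mI mwt wt0 1 (-1) lu hg.
by congr wL2; apply/funext => z /=; ring.
Qed.

Lemma sqnorm_lin_star u (a b : R) : V u ->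
  sqnorm_phase D (T (fun z => a * u z + b * ustar z)) =
  a ^+ 2 * sqnorm_phase D (T u).
Proof.
move=> Vu; have [Vs Ts _] := hstar.
have [Vv eT _] := V_space_lin a b Vu Vs.
have [_ _ /L2_phaseE lu _] := Vu; have [_ _ /L2_phaseE lv _] := Vv.
rewrite !sqnorm_phaseE; apply: wdot_aeZ2 => //.
by apply: filterS2 eT Ts => z h1 h2 Dz; rewrite h1// h2// mulr0 addr0.
Qed.

Lemma trace_lin_star u (a b : R) : V u ->
  \forall z \ae mub, inflow D n z ->
    tr (fun z => a * u z + b * ustar z) z = a * tr u z + b * g z.
Proof.
move=> Vu; have [Vs _ gs] := hstar.
have [_ _ et] := V_space_lin a b Vu Vs.
by apply: filterS2 et gs => z h1 h2 iz; rewrite h1// h2.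
Qed.

Variables (gamma : R) (gamma0 : 0 < gamma).

(** Minimality along the line through [ustar] and [u], in the form of [quadratic_argmin1]: [m] is
    the left-hand side and [c] the right-hand side of the conclusion. *)
Lemma argmin_energy u lambda : L2_inflow D n lambda ->
  is_argmin V (fun v => Lagrangian D n sA sT p gamma g v lambda) u ->
  sqnorm_phase D (T u) + gamma * inner_inflow D n (tr u \- g) (tr u \- g) =
  inner_inflow D n lambda (tr u \- g).
Proof.
move=> ll [Vu minu]; have [Vs _ _] := hstar.
have lg := V_space_gap Vu.
apply: quadratic_argmin1.
  rewrite addr_ge0//; first by rewrite sqnorm_phaseE wdot_ge0.
  by rewrite mulr_ge0 ?(ltW gamma0)//; exact: wdot_ge0.
(* The coefficients sum to [1], so the boundary mismatch with [g] is exactly scaled by [s]. *)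
move=> s; have [Vv _ _] := V_space_lin s (1 - s) Vu Vs.
have lv := V_space_gap Vv.
have e : \forall z \ae mub, inflow D n z ->
    (tr (fun z => s * u z + (1 - s) * ustar z) \- g) z = s * (tr u \- g) z.
  by apply: filterS (trace_lin_star s (1 - s) Vu) => z /[apply] /= ->; ring.
have := minu _ Vv; rewrite /Lagrangian /J sqnorm_lin_star//.
have -> : inner_inflow D n lambda (tr (fun z => s * u z + (1 - s) * ustar z) \- g) =
    s * inner_inflow D n lambda (tr u \- g).
  exact: (wdot_aeZ mI mwt wt0 lg lv ll e).
have -> : inner_inflow D n (tr (fun z => s * u z + (1 - s) * ustar z) \- g)
    (tr (fun z => s * u z + (1 - s) * ustar z) \- g) =
    s ^+ 2 * inner_inflow D n (tr u \- g) (tr u \- g).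
  exact: (wdot_aeZ2 mI mwt wt0 lg lv e).
set x := sqnorm_phase _ _; set y := inner_inflow _ _ _ _; set c := inner_inflow _ _ _ _.
by move=> h; apply: le_trans (le_trans _ h) _; rewrite le_eqVlt; apply/orP; left;
  apply/eqP; field.
Qed.

Lemma V_norm_sub_star u : V u ->
  V_norm D n sA sT p (u \- ustar) =
  Num.sqrt (sqnorm_phase D (T u) + inner_inflow D n (tr u \- g) (tr u \- g)).
Proof.
move=> Vu; have [Vs _ _] := hstar.
have -> : u \- ustar = (fun z => 1 * u z + -1 * ustar z).
  by apply/funext => z /=; ring.
have [Vv _ _] := V_space_lin 1 (-1) Vu Vs.
rewrite /V_norm sqnorm_lin_star// expr1n mul1r; congr (Num.sqrt (_ + _)).
have [_ lv] := V_space_trace Vv; have lg := V_space_gap Vu.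
(* The trace of the difference is [1] times [tr u - g]; the factor [1 ^+ 2] matches [wdot_aeZ2]. *)
rewrite -[RHS]mul1r -[X in X * _](expr1n _ 2).
apply: (wdot_aeZ2 mI mwt wt0 lg lv).
by apply: filterS (trace_lin_star 1 (-1) Vu) => z /[apply] /= ->; ring.
Qed.

Lemma uzawa_energy_step u lambda lambda' (rho : R) : V u ->
  L2_inflow D n lambda -> L2_inflow D n lambda' ->
  (\forall z \ae mub, inflow D n z -> lambda' z = lambda z - rho * (tr u z - g z)) ->
  inner_inflow D n lambda' lambda' = inner_inflow D n lambda lambda -
    2 * rho * inner_inflow D n lambda (tr u \- g) +
    rho ^+ 2 * inner_inflow D n (tr u \- g) (tr u \- g).
Proof.
move=> Vu ll ll' e; have lg := V_space_gap Vu.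
pose l := fun z => 1 * lambda z + (- rho) * (tr u \- g) z.
have wl : wL2 mub (inflow D n) wt l by exact: wL2_lin.
have e' : \forall z \ae mub, inflow D n z -> lambda' z = l z.
  by apply: filterS e => z /[apply] ->; rewrite /l /=; ring.
have -> : inner_inflow D n lambda' lambda' = wdot mub (inflow D n) wt l l.
  exact: wdot_ae.
rewrite {1}/l (wdot_linl mI mwt wt0)// !(wdot_linr mI mwt wt0)//.
rewrite (wdotC _ _ _ (tr u \- g) lambda) /inner_inflow /wdot.
by ring.
Qed.

End uzawa.

Theorem theorem3p5 (R : realType) (d : nat) (hd : d = 2%N \/ d = 3%N)
  (D : set 'rV[R]_d) (n : 'rV[R]_d -> 'rV[R]_d)
  (hD : spatial_domain D) (hn : outward_unit_normal D n)
  (sigmaA sigmaT : R) (hA : 0 <= sigmaA) (hT : 0 <= sigmaT)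
  (p : R -> R) (hp : phase_function p)
  (g : 'rV[R]_d * 'rV[R]_d -> R) (hg : L2_inflow D n g)
  (gamma rho : R) (hgamma : 0 < gamma) (hrho : 0 < rho < 2 * gamma)
  (ustar : 'rV[R]_d * 'rV[R]_d -> R)
  (hustar : bvp_solution D n sigmaA sigmaT p g ustar)
  (u lambda : nat -> 'rV[R]_d * 'rV[R]_d -> R)
  (hu : uzawa D n sigmaA sigmaT p gamma rho g u lambda) :
  V_norm D n sigmaA sigmaT p (u k \- ustar) @[k --> \oo] --> (0 : R).
Proof.
have [oD _ _] := hD; have [mn _] := hn; have /andP[rho0 rhog] := hrho.
have Vu k : V_space D n sigmaA sigmaT p (u k) by have [_ []] := hu k.
under eq_fun do rewrite (V_norm_sub_star oD mn hp hg hustar (Vu _)).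
rewrite -(@sqrtr0 R); apply: continuous_cvg; first exact: sqrt_continuous.
(* The smaller of the two coefficients in the decrease of the squared multiplier norm; the bound
   [rho < 2 * gamma] makes it positive. *)
pose c := Num.min (2 * rho) (rho * (2 * gamma - rho)).
have c0 : 0 < c by rewrite lt_min !mulr_gt0// subr_gt0.
have ip_ge0 h : 0 <= inner_inflow D n h h.
  by apply: wdot_ge0 => z; exact: normr_ge0.
have sq_ge0 h : 0 <= sqnorm_phase D h.
  by rewrite sqnorm_phaseE wdot_ge0.
apply: (descent_cvg0 (L := fun k => inner_inflow D n (lambda k) (lambda k)) c0) => //.
  by move=> k; rewrite addr_ge0.
move=> k; have [lk mk ek] := hu k; have [lk' _ _] := hu k.+1.
rewrite (uzawa_energy_step mn hg (Vu k) lk lk' ek).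
(* With [a] the squared residual and [b] the squared boundary mismatch, the cross term becomes
   [a + gamma * b], and the decrease is [2 * rho * a + rho * (2 * gamma - rho) * b]. *)
rewrite -(argmin_energy oD mn hp hg hustar hgamma lk mk).
move: (sq_ge0 (transport_scattering D sigmaA sigmaT p (u k))).
move: (ip_ge0 (trace D n (u k) \- g)).
move: (sqnorm_phase _ _) (inner_inflow _ _ (trace _ _ _ \- g) _) => a b b0 a0.
have ca : c * a <= 2 * rho * a by rewrite ler_wpM2r// ge_min lexx.
have cb : c * b <= rho * (2 * gamma - rho) * b.
  by rewrite ler_wpM2r// ge_min lexx orbT.
by rewrite mulrDr; move: ca cb; lra.
Qed.
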